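(* Consider the TDC iterations with importance weighting $$\theta_{n+1}=\theta_n+a(n)\rho_n\left[\delta_n(\theta_n)\phi_n-\gamma\phi_n'\phi_n^Tw_n\right],\qquad w_{n+1}=w_n+b(n)\left[(\rho_n\delta_n(\theta_n)-\phi_n^Tw_n)\phi_n\right],$$ in the setting described in the context, and assume: (i) $a(n),b(n)$ are positive and non-increasing, $\sum_na(n)=\sum_nb(n)=\infty$, $\sum_n(a(n)^2+b(n)^2)<\infty$, $a(n)/b(n)\to0$; (ii) $\{(X_n,R_n,X_{n+1}),\,n\ge0\}$ is such that $\{X_n\}$ is a time-homogeneous finite state irreducible Markov chain generated from the behaviour policy $\pi_b$ with unique stationary distribution $\nu$; $E[R_n|X_n=s,X_{n+1}=s']=\sum_{a}\pi_b(a|s)r(s,a,s')$ and $P(X_{n+1}=s'|X_n=s)=\sum_{a}\pi_b(a|s)p(s'|s,a)$, the sums being over all actions $a$, where $\pi_b$ is the behaviour policy and $\pi\ne\pi_b$; also $E[R_n^2|X_n,X_{n+1}]<\infty$ for all $n$ almost surely; (iii) $C=E[\phi(X)\phi(X)^T]$ and $A=E[\rho_{X,A_n}\phi(X)(\phi(X)-\gamma\phi(X_{n+1}))^T]$ are non-singular, where $X\sim\nu$; (iv) $\pi_b(a|s)>0$ for all states $s$ and actions $a$; (v) $\sup_n(\|\theta_n\|+\|w_n\|)<\infty$ with probability one. Then the parameter vector $\theta_n$ converges with probability one as $n\to\infty$ to the TD(0) solution, i.e. to the solution $\theta^*\in\mathbb{R}^d$ of $$0=\sum_{s,a,s'}\nu(s)\pi(a|s)p(s'|s,a)\,\delta(\theta;s,a,s')\,\phi(s)=E[\rho_{X,A_n}\delta_{X,R_n,X_{n+1}}(\theta)\phi(X)]=b-A\theta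 .$$
   Context: A Markov decision process with finite state space $S$ and finite action space (the action space is also denoted $A$ in places, not to be confused with the matrix $A$) is specified by the expected reward $r(s,a,s')$ and the transition probability kernel $p(s'|s,a)$. $\pi(a|s)$ is the target policy and $\pi_b(a|s)$ the behaviour policy; $0<\gamma<1$ is the discount factor; $\phi:S\to\mathbb{R}^d$ is the vector of state features; $\theta_n,w_n\in\mathbb{R}^d$. One is given an on-policy trajectory $(X_n,A_n,R_n,X_{n+1})$, $n\ge0$ (current state, action, reward, next state), generated from the behaviour policy $\pi_b$, so that actions $A_n$ are chosen according to $\pi_b(\cdot|X_n)$ and next states according to $p(\cdot|X_n,A_n)$. Notation: $\phi_n=\phi(X_n)$, $\phi_n'=\phi(X_{n+1})$; $\rho_{X,A_n}=\pi(A_n|X)/\pi_b(A_n|X)$ and $\rho_n=\rho_{X_n,A_n}$; $\delta_{X,R_n,X_{n+1}}(\theta)=R_n+\gamma\theta^T\phi(X_{n+1})-\theta^T\phi(X)$ is the online temporal difference and $\delta_n(\theta)=\delta_{X_n,R_n,X_{n+1}}(\theta)$; $\delta(\theta;s,a,s')=r(s,a,s')+\gamma\theta^T\phi(s')-\theta^T\phi(s)$ is the temporal difference term with expected reward; $b=E[\rho_{X,A_n}R_n\phi(X)]$. In expectations involving $X$, $X\sim\nu$ plays the role of the current state $X_n$. (The scalars $b(n)$ are step sizes, unrelated to the vector $b$.)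
   Formalization: The reward R_n is assumed drawn, given the past and (X_n,A_n,X_{n+1})=(s,a,s'), from a fixed law not depending on n, with mean r(s,a,s'); with only the stated moment conditions the claim fails (e.g. R_n=n² with probability 1/n², else 0). *)

(* Defs.v *)
From HB Require Import structures.
From mathcomp Require Import all_boot all_order all_algebra.
From mathcomp Require Import all_classical all_reals all_analysis.
Export numFieldNormedType.Exports.

Set Implicit Arguments.
Unset Strict Implicit.
Unset Printing Implicit Defensive.

Import Order.TTheory GRing.Theory Num.Theory.
Local Open Scope classical_set_scope.
Local Open Scope ring_scope.

Definition is_distr (R : realType) (I : finType) (mu : I -> R) : Prop :=
  (forall i, 0 <= mu i) /\ \sum_i mu i = 1.

(* [state_kernel pol p s s'] is sum_a pol(a|s) p(s'|s,a); [pol s a] stands for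
   pol(a|s) and [p s a s'] for p(s'|s,a). *)
Definition state_kernel (R : realType) (S U : finType)
    (pol : S -> U -> R) (p : S -> U -> S -> R) (s s' : S) : R :=
  \sum_a pol s a * p s a s'.

Fixpoint nstep (R : realType) (S : finType) (K : S -> S -> R) (n : nat)
    (s s' : S) : R :=
  if n is m.+1 then \sum_u K s u * nstep K m u s' else (s == s')%:R.

Definition irreducible_kernel (R : realType) (S : finType) (K : S -> S -> R) :
    Prop :=
  forall s s', exists n, 0 < nstep K n s s'.

Definition stationary (R : realType) (S : finType) (K : S -> S -> R)
    (nu : S -> R) : Prop :=
  is_distr nu /\ forall s', \sum_s nu s * K s s' = nu s'.

Definition unique_stationary (R : realType) (S : finType) (K : S -> S -> R)
    (nu : S -> R) : Prop :=
  stationary K nu /\ forall nu', stationary K nu' -> nu' = nu.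

Section Chain.
Context d (T : measurableType d) (R : realType) (P : probability T R).

(* Elementary conditional expectation E[f | E] on an event of positive
   probability. *)
Definition cond_mean (f : T -> R) (E : set T) : \bar R :=
  (((fine (P E))^-1)%:E * \int[P]_(w in E) (f w)%:E)%E.

Definition markov_chain (S : finType) (K : S -> S -> R) (X : nat -> T -> S) :
    Prop :=
  forall n (x : nat -> S),
    P [set w | forall k, (k <= n.+1)%N -> X k w = x k] =
    (P [set w | forall k, (k <= n)%N -> X k w = x k]
      * (K (x n) (x n.+1))%:E)%E.

(* The sigma-algebra generated by theta_0, w_0, X_0, ..., X_n, A_0, ...,
   A_(n-1), R_0, ..., R_(n-1). *)
Definition history (S U : finType) (dim : nat) (theta0 w0 : T -> 'cV[R]_dim)
    (X : nat -> T -> S) (Ac : nat -> T -> U) (Rw : nat -> T -> R) (n : nat) :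
    set (set T) :=
  <<s [set E | [\/ exists i, exists2 B : set R, measurable B &
                     E = (fun w => theta0 w i 0) @^-1` B
                     \/ E = (fun w => w0 w i 0) @^-1` B,
                   exists2 k, (k <= n)%N & exists s, E = X k @^-1` [set s],
                   exists2 k, (k < n)%N & exists a, E = Ac k @^-1` [set a] |
                   exists2 k, (k < n)%N & exists2 B : set R, measurable B &
                     E = Rw k @^-1` B ] ] >>.

(* The trajectory is generated by the policy [pol] in the decision process with
   transition kernel [p] and reward law [q]: conditionally on the history up to
   time n, A_n has law pol(.|X_n), X_(n+1) has law p(.|X_n,A_n), and R_n has
   law q(X_n,A_n,X_(n+1)). *)
Definition generated_by (S U : finType) (dim : nat)
    (pol : S -> U -> R) (p : S -> U -> S -> R)
    (q : S -> U -> S -> probability R R)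
    (theta0 w0 : T -> 'cV[R]_dim)
    (X : nat -> T -> S) (Ac : nat -> T -> U) (Rw : nat -> T -> R) : Prop :=
  forall n (E : set T) s a s' (B : set R),
    history theta0 w0 X Ac Rw n E -> measurable B ->
    P (E `&` [set w | [/\ X n w = s, Ac n w = a, X n.+1 w = s' & B (Rw n w)]]) =
    (P (E `&` [set w | X n w = s]) * (pol s a * p s a s')%:E * q s a s' B)%E.

End Chain.

(* Expectation (entrywise) of f(X, A_n, R_n, X_(n+1)) when X ~ nu and
   A_n, R_n, X_(n+1) are drawn from [pol], [q], [p]. *)
Definition stat_mean (R : realType) (S U : finType)
    (nu : S -> R) (pol : S -> U -> R) (p : S -> U -> S -> R)
    (q : S -> U -> S -> probability R R) (m n : nat)
    (f : S -> U -> R -> S -> 'M[R]_(m, n)) : 'M[R]_(m, n) :=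
  \matrix_(i, j) \sum_s \sum_a \sum_s'
    nu s * pol s a * p s a s' * \int[q s a s']_x (f s a x s' i j).

Definition dotv (R : realType) (dim : nat) (u v : 'cV[R]_dim) : R :=
  (u^T *m v) 0 0.

(* Temporal difference for features [phi], current state s, reward x, next
   state s'. *)
Definition td (R : realType) (S : finType) (dim : nat) (gamma : R)
    (phi : S -> 'cV[R]_dim) (theta : 'cV[R]_dim) (s : S) (x : R) (s' : S) : R :=
  x + gamma * dotv theta (phi s') - dotv theta (phi s).

Definition isratio (R : realType) (S U : finType) (pi pib : S -> U -> R)
    (s : S) (a : U) : R := pi s a / pib s a.

(* Main.v *)
Require Import Defs.
From HB Require Import structures.
From mathcomp Require Import all_boot all_order all_algebra.
From mathcomp Require Import all_classical all_reals all_analysis.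
From mathcomp Require Import measurable_realfun ring lra.

Set Implicit Arguments.
Unset Strict Implicit.
Unset Printing Implicit Defensive.

Import Order.TTheory GRing.Theory Num.Theory.
Local Open Scope classical_set_scope.
Local Open Scope ring_scope.

(** Averaging the two updates over the stationary law of the chain gives the
linear fields [b - A theta - (C - A^T) w] for [theta], because the importance
weights turn [E[rho phi' phi^T]] into [(C - A^T) / gamma], and
[b - A theta - C w] for [w].  The second recursion is infinitely faster and
drives [w] to [C^-1 (b - A theta)]; substituting this value, the first field
becomes [A^T C^-1 (b - A theta)], and [A^T C^-1 A] is symmetric positive
definite.  Hence [theta] is attracted by the solution of [A theta = b].

Everything being linear and the iterates being bounded by assumption, the limits
can be taken on the recursions themselves.  Both the gap
[v = w - C^-1 (b - A theta)] and the error [u = theta - theta*] satisfy a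
recursion [x' = x + c (f - Q x) + delta] with [Q] symmetric positive definite,
[f] tending to 0 and [delta] the terms of a convergent series.
[stochastic_approximation_cvg0] shows that such a sequence vanishes: it absorbs
the tail of the series into [x] and then contracts the squared Euclidean norm.
It is applied first to [v], where [f] is small since [a / b] tends to 0, and
then to [u], where [f] is small since [v] tends to 0 ([tdc_pathwise_cvg]).

What remains is probabilistic: the noise series have to converge almost surely.
The noise is a finite combination of terms [c_n zeta_n (F_n - mean)], in which
[zeta_n] is 1 or a coordinate of an iterate and [F_n] is an affine function of
the reward [R_n] with coefficients depending on [X_n], [A_n], [X_(n+1)].  The
solution [V] of the Poisson equation of the chain ([poisson_solution]) splits
[F_n - mean] into a martingale difference and [V(X_n) - V(X_(n+1))].  The second
part is summed by parts ([summation_by_parts_cvg]); the first one is handled by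
the convergence theorem for square integrable martingales
([martingale_series_cvg]), after truncation of the random multiplier [zeta_n]
([martingale_noise_cvg]).  That the differences are centered against every
bounded function of the past comes from [integral_cond_law], which identifies
the joint law of the past and of the current reward with a product measure. *)

(** * Quadratic forms on column vectors *)

Section quadratic_forms.
Context (R : realType) (dim : nat).
Implicit Types (u v x y : 'cV[R]_dim) (Q M : 'M[R]_dim).

Lemma dotvE u v : dotv u v = \sum_i u i 0 * v i 0.
Proof. by rewrite /dotv mxE; apply: eq_bigr => i _; rewrite mxE. Qed.

Lemma dotvC u v : dotv u v = dotv v u.
Proof. by rewrite !dotvE; apply: eq_bigr => i _; rewrite mulrC. Qed.

Lemma dotvDr u v x : dotv u (v + x) = dotv u v + dotv u x.
Proof. by rewrite /dotv mulmxDr mxE. Qed.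

Lemma dotvDl u v x : dotv (u + v) x = dotv u x + dotv v x.
Proof. by rewrite dotvC dotvDr !(dotvC x). Qed.

Lemma dotvZr (k : R) u v : dotv u (k *: v) = k * dotv u v.
Proof. by rewrite /dotv -scalemxAr mxE. Qed.

Lemma dotvZl (k : R) u v : dotv (k *: u) v = k * dotv u v.
Proof. by rewrite dotvC dotvZr dotvC. Qed.

Lemma dotvNr u v : dotv u (- v) = - dotv u v.
Proof. by rewrite -scaleN1r dotvZr mulN1r. Qed.

Lemma dotvNl u v : dotv (- u) v = - dotv u v.
Proof. by rewrite dotvC dotvNr dotvC. Qed.

Lemma dotv_mulmx M u v : dotv u (M *m v) = dotv (M^T *m u) v.
Proof. by rewrite /dotv trmx_mul trmxK mulmxA. Qed.

Lemma dotv_ge0 u : 0 <= dotv u u.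
Proof. by rewrite dotvE sumr_ge0// => i _; rewrite -expr2 sqr_ge0. Qed.

Lemma dotvD_le u v : dotv (u + v) (u + v) <= 2 * dotv u u + 2 * dotv v v.
Proof.
have := dotv_ge0 (u - v); rewrite !(dotvDl, dotvDr, dotvNl, dotvNr) (dotvC v u).
lra.
Qed.

(** The quadratic [t |-> <x + t y, Q (x + t y)>] is nonnegative, so its
discriminant is nonpositive.  As [Q] may be degenerate, the leading coefficient
can vanish; the linear one must then vanish as well. *)
Lemma psd_cauchy_schwarz Q x y : Q^T = Q -> (forall u, 0 <= dotv u (Q *m u)) ->
  dotv x (Q *m y) ^+ 2 <= dotv x (Q *m x) * dotv y (Q *m y).
Proof.
move=> Qs Q0.
have sym : dotv y (Q *m x) = dotv x (Q *m y) by rewrite dotv_mulmx Qs dotvC.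
have H t : 0 <= dotv x (Q *m x) + 2 * t * dotv x (Q *m y) + t ^+ 2 * dotv y (Q *m y).
  have := Q0 (x + t *: y).
  rewrite mulmxDr -scalemxAr !(dotvDl, dotvDr, dotvZl, dotvZr) sym; lra.
have := Q0 x; have := Q0 y.
move: (dotv x (Q *m x)) (dotv x (Q *m y)) (dotv y (Q *m y)) H => A B C H C0 A0.
have [Cz|Cnz] := eqVneq C 0.
  have [->|Bnz] := eqVneq B 0; first by rewrite expr0n/= mulr_ge0.
  (* at this t the affine function A + 2 t B takes the value -1 *)
  have := H (- (A + 1) / (2 * B)); rewrite Cz mulr0 addr0.
  have -> : A + 2 * (- (A + 1) / (2 * B)) * B = -1 by field.
  lra.
have Cp : 0 < C by rewrite lt0r Cnz.
have := H (- B / C).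
have -> : A + 2 * (- B / C) * B + (- B / C) ^+ 2 * C = (A * C - B ^+ 2) / C by field.
by rewrite pmulr_lge0 ?invr_gt0// subr_ge0.
Qed.

Lemma cauchy_schwarz x y : dotv x y ^+ 2 <= dotv x x * dotv y y.
Proof.
have := @psd_cauchy_schwarz 1%:M x y; rewrite !mul1mx; apply; first exact: trmx1.
by move=> u; rewrite mul1mx dotv_ge0.
Qed.

Lemma mulmx_bounded M : exists2 L, 0 < L &
  forall y, dotv (M *m y) (M *m y) <= L * dotv y y.
Proof.
exists (\sum_i dotv (row i M)^T (row i M)^T + 1).
  by rewrite ltr_wpDl// sumr_ge0// => i _; exact: dotv_ge0.
move=> y; rewrite mulrDl mul1r.
rewrite (@le_trans _ _ ((\sum_i dotv (row i M)^T (row i M)^T) * dotv y y))//; last first.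
  by rewrite lerDl dotv_ge0.
rewrite dotvE mulr_suml; apply: ler_sum => i _.
have -> : (M *m y) i 0 = dotv (row i M)^T y.
  by rewrite /dotv trmxK !mxE; apply: eq_bigr => j _; rewrite mxE.
by rewrite -expr2; exact: cauchy_schwarz.
Qed.

(** Cauchy-Schwarz for the form of [Q] at [Q y] and [y] reads
[|Q y|^4 <= <Q y, Q Q y> <y, Q y>]; since [Q] is bounded, [|Q y|^2] is controlled
by [<y, Q y>], and since [Q^-1] is bounded so is [|y|^2]. *)
Lemma psd_unit_coercive Q : Q^T = Q -> (forall u, 0 <= dotv u (Q *m u)) ->
  Q \in unitmx -> exists2 k, 0 < k &
  forall y, k * dotv y y <= dotv y (Q *m y) /\
            k * dotv (Q *m y) (Q *m y) <= dotv y (Q *m y).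
Proof.
move=> Qs Q0 Qu.
have [L L0 LQ] := mulmx_bounded Q.
have [L' L'0 LQ'] := mulmx_bounded (invmx Q).
have up z : dotv z (Q *m z) <= (1 + L) * dotv z z.
  have := dotv_ge0 (z - Q *m z); rewrite !(dotvDl, dotvDr, dotvNl, dotvNr).
  have := dotv_ge0 z; have := LQ z; rewrite (dotvC (Q *m z) z); have := Q0 z; nra.
have low y : dotv (Q *m y) (Q *m y) <= (1 + L) * dotv y (Q *m y).
  have := @psd_cauchy_schwarz Q (Q *m y) y Qs Q0.
  have := up (Q *m y); have := dotv_ge0 (Q *m y); have := Q0 y.
  move: (dotv (Q *m y) (Q *m y)) (dotv y (Q *m y)) (dotv (Q *m y) (Q *m (Q *m y))) => a b c b0 a0 ca acb.
  have [->|an] := eqVneq a 0; first by rewrite mulr_ge0// addr_ge0// ltW.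
  have ap : 0 < a by rewrite lt0r an.
  rewrite -(ler_pM2l ap); nra.
have c0 : 0 < (1 + L) * (1 + L') by rewrite mulr_gt0// addr_gt0.
exists ((1 + L) * (1 + L'))^-1; first by rewrite invr_gt0.
move=> y; rewrite !ler_pdivrMl//; split.
  have := LQ' (Q *m y); rewrite mulKmx// => h; apply: le_trans h _.
  have := low y; have := Q0 y; nra.
apply: le_trans (low y) _; rewrite ler_wpM2r// ler_peMr//; lra.
Qed.

End quadratic_forms.

(** * Sequences, series and linear recursions *)

Section deterministic_recursions.
Context (R : realType).
Implicit Types (b c e x z V : nat -> R).

(** Once [k b <= 1] and [e <= k eps / 2], a value [x >= eps] makes the sequence decrease by at
least [k b eps / 2]; as the [b n] have an infinite sum, it must pass below
[eps], and it cannot come back. *)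
Lemma contraction_cvg0 (k : R) b e x : 0 < k -> (forall n, 0 < b n) ->
  b n @[n --> \oo] --> 0 -> series b n @[n --> \oo] --> +oo ->
  e n @[n --> \oo] --> 0 -> (forall n, 0 <= x n) ->
  (\forall n \near \oo, x n.+1 <= (1 - k * b n) * x n + b n * e n) ->
  x n @[n --> \oo] --> 0.
Proof.
move=> k0 b0 bc bs ec x0 rec.
apply/cvgr0Pnorm_lt => eps eps0.
have h0 : 0 < eps / 2 by rewrite divr_gt0.
have kh0 : 0 < k * (eps / 2) by rewrite mulr_gt0.
have [N _ NP] : \forall n \near \oo, [/\ k * b n <= 1, e n <= k * (eps / 2) &
    x n.+1 <= (1 - k * b n) * x n + b n * e n].
  near=> n; split; last by near: n.
  - rewrite mulrC -ler_pdivlMr// div1r.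
    apply: le_trans (ler_norm _) _; near: n.
    by apply: (cvgr0_norm_le _ bc); rewrite invr_gt0.
  - by apply: le_trans (ler_norm _) _; near: n; exact: (cvgr0_norm_le _ ec).
have step n : (N <= n)%N -> x n.+1 <= (1 - k * b n) * x n + b n * (k * (eps / 2)).
  by move=> /NP[_ en rn]; apply: le_trans rn _; rewrite lerD2l ler_wpM2l// ltW.
have [M NM xM] : exists2 M, (N <= M)%N & x M < eps.
  apply: contrapT => nex.
  have big n : (N <= n)%N -> eps <= x n.
    by move=> Nn; rewrite leNgt; apply/negP => xn; apply: nex; exists n.
  have dec n : x (N + n)%N <= x N - k * (eps / 2) * (series b (N + n)%N - series b N).
    elim: n => [|n IH]; first by rewrite addn0 subrr mulr0 subr0.
    have := step _ (leq_addr n N); have := big _ (leq_addr n N).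
    rewrite addnS [series b (N + n).+1]seriesSr /=.
    have := b0 (N + n)%N; move: IH.
    move: (x (N + n)%N) (series b (N + n)%N) (b (N + n)%N) (x (N + n).+1) => y s bb y' IH bb0 ye y'y.
    apply: le_trans y'y _.
    have : 0 <= k * bb * (y - eps) by rewrite mulr_ge0 ?subr_ge0// mulr_ge0// ltW.
    nra.
  (* the sum of the steps past N needed to push x below 0 *)
  move/cvgryPge : bs => /(_ (series b N + (x N + 1) / (k * (eps / 2)))) [m _ mP].
  have := dec m; have := mP (N + m)%N (leq_addl _ _); have := x0 (N + m)%N.
  move=> xp; rewrite -lerBrDl ler_pdivrMr// => s1 s2.
  have := le_trans xp s2; rewrite subr_ge0 mulrC => /(le_trans s1).
  by rewrite gerDl ler10.
exists M => // n /= Mn.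
rewrite ger0_norm//.
elim: n Mn => [|n IH]; first by rewrite leqn0 => /eqP <-.
rewrite leq_eqVlt => /predU1P[<-//|]; rewrite ltnS => Mn.
have Nn := leq_trans NM Mn.
have [kb _ _] := NP n Nn.
apply: le_lt_trans (step n Nn) _.
have : (1 - k * b n) * x n <= (1 - k * b n) * eps.
  by rewrite ler_wpM2l ?subr_ge0// ltW// IH.
have : 0 < k * b n * eps by rewrite !mulr_gt0.
nra.
Unshelve. all: by end_near. Qed.

(** After summation by parts the factors of [V] are the variations of [c z],
which are absolutely summable: those of the monotone sequence [c] telescope and
those of [z] are summable once weighted by [c]. *)
Lemma summation_by_parts_cvg (c z V : nat -> R) (Z W : R) :
  (forall n, 0 <= c n) -> (forall n, c n.+1 <= c n) -> c n @[n --> \oo] --> 0 ->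
  (forall n, `|z n| <= Z) -> (forall n, `|V n| <= W) ->
  cvgn (series (fun n => c n * `|z n.+1 - z n|)) ->
  cvgn (series (fun n => c n * z n * (V n - V n.+1))).
Proof.
move=> c0 cn cc zZ VW cz.
have Z0 : 0 <= Z := le_trans (normr_ge0 _) (zZ 0).
have W0 : 0 <= W := le_trans (normr_ge0 _) (VW 0).
have E n : series (fun n => c n * z n * (V n - V n.+1)) n =
  c 0 * z 0 * V 0 - c n * (z n * V n) +
  series (fun n => (c n.+1 * z n.+1 - c n * z n) * V n.+1) n.
  elim: n => [|n IH]; first by rewrite /series/= !big_geq//; ring.
  by rewrite !seriesSr IH; ring.
rewrite (_ : series _ = fun n => c 0 * z 0 * V 0 - c n * (z n * V n) +
  series (fun n => (c n.+1 * z n.+1 - c n * z n) * V n.+1) n); last exact/funext.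
apply: is_cvgD; first apply: is_cvgB.
- exact: is_cvg_cst.
- apply/cvg_ex; exists 0.
  apply/cvgr0Pnorm_le => eps eps0.
  have q0 : 0 < Z * W + 1 by rewrite ltr_wpDl// mulr_ge0.
  near=> n; rewrite normrM.
  apply: (@le_trans _ _ (eps / (Z * W + 1) * (Z * W + 1))); last by rewrite divfK// gt_eqF.
  apply: ler_pM => //; last by rewrite normrM ler_wpDr// ler_pM.
  by near: n; apply: (cvgr0_norm_le _ cc); rewrite divr_gt0.
- apply: normed_cvg.
  apply: (@series_le_cvg _ _ (fun n => Z * W * (c n - c n.+1) + W * (c n * `|z n.+1 - z n|))).
  + by move=> n; exact: normr_ge0.
  + by move=> n; rewrite addr_ge0// ?mulr_ge0// subr_ge0.
  + move=> n; rewrite /= normrM.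
    rewrite (_ : c n.+1 * z n.+1 - c n * z n =
      (c n.+1 - c n) * z n.+1 + c n * (z n.+1 - z n)); last by ring.
    apply: (@le_trans _ _ ((`|c n.+1 - c n| * `|z n.+1| + c n * `|z n.+1 - z n|) * W)).
      rewrite ler_pM// (le_trans (ler_normD _ _))// !normrM lerD2l.
      by rewrite (ger0_norm (c0 n)).
    rewrite distrC ger0_norm ?subr_ge0//.
    have : (c n - c n.+1) * `|z n.+1| <= (c n - c n.+1) * Z by rewrite ler_wpM2l// subr_ge0.
    move: (_ * `|z n.+1|) (c n * _) => p q pq.
    rewrite mulrDl [W * q]mulrC lerD2r -mulrA mulrC [in leRHS]mulrCA ler_wpM2l//.
    by rewrite mulrC.
  + rewrite (_ : series _ = fun n => Z * W * (c 0 - c n) +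
        W * series (fun n => c n * `|z n.+1 - z n|) n).
      apply: is_cvgD; apply: is_cvgMr => //.
      by apply: is_cvgB; [exact: is_cvg_cst|apply/cvg_ex; exists 0].
    apply/funext; elim=> [|n IH]; first by rewrite /series/= !big_geq// subrr !mulr0 addr0.
    by rewrite !seriesSr IH; ring.
Unshelve. all: by end_near. Qed.

Lemma cvg0_mull (k : R) x : x n @[n --> \oo] --> 0 -> k * x n @[n --> \oo] --> 0.
Proof.
by move=> xc; rewrite -[X in _ --> X](mulr0 k); apply: cvgM => //; exact: cvg_cst.
Qed.

Lemma cvg0_add x z : x n @[n --> \oo] --> 0 -> z n @[n --> \oo] --> 0 ->
  x n + z n @[n --> \oo] --> 0.
Proof. by move=> xc zc; rewrite -[X in _ --> X](addr0 0); apply: cvgD. Qed.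

Lemma cvgn_seriesD (x y : nat -> R) : cvgn (series x) -> cvgn (series y) ->
  cvgn (series (fun n => x n + y n)).
Proof. by move=> cx cy; rewrite (_ : (fun n => _) = x + y)//; exact: is_cvg_seriesD. Qed.

Lemma cvgn_seriesZ (k : R) (x : nat -> R) : cvgn (series x) ->
  cvgn (series (fun n => k * x n)).
Proof. by move=> cx; exact: is_cvg_seriesZ. Qed.

Lemma cvgn_series_sum (I : Type) (s : seq I) (x : I -> nat -> R) :
  (forall i, cvgn (series (x i))) -> cvgn (series (fun n => \sum_(i <- s) x i n)).
Proof.
move=> cx; elim: s => [|i s IH].
  rewrite (_ : series _ = fun=> 0); first exact: is_cvg_cst.
  by apply/funext => n; rewrite /series/= big1// => k _; rewrite big_nil.
rewrite (_ : (fun n => _) = fun n => x i n + \sum_(j <- s) x j n).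
  exact: cvgn_seriesD.
by apply/funext => n; rewrite big_cons.
Qed.

Lemma square_summable_cvg0 c : (forall n, 0 <= c n) ->
  cvgn (series (fun n => c n ^+ 2)) -> c n @[n --> \oo] --> 0.
Proof.
move=> c0 /cvg_series_cvg_0/cvgr0Pnorm_lt h; apply/cvgr0Pnorm_lt => eps eps0.
have /h : 0 < eps ^+ 2 by rewrite exprn_gt0.
by apply: filterS => n; rewrite normrX ltr_pXn2r// nnegrE// ltW.
Qed.

Lemma cvg_sum_seq (I : Type) (s : seq I) (u : I -> nat -> R) (l : I -> R) :
  (forall i, u i n @[n --> \oo] --> l i) ->
  (\sum_(i <- s) u i n) @[n --> \oo] --> \sum_(i <- s) l i.
Proof.
move=> ul; elim: s => [|i s IH].
  by under eq_fun do rewrite big_nil; rewrite big_nil; exact: cvg_cst.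
by under eq_fun do rewrite big_cons; rewrite big_cons; apply: cvgD.
Qed.

Variable dim : nat.
Implicit Types (v f delta : nat -> 'cV[R]_dim).

Lemma dotv_cvg0 v : (forall i, v n i 0 @[n --> \oo] --> 0) ->
  dotv (v n) (v n) @[n --> \oo] --> 0.
Proof.
move=> vc.
have z : \sum_(i < dim) (0 : R) = 0 by rewrite big1.
have h : (\sum_i v n i 0 * v n i 0) @[n --> \oo] --> \sum_(i < dim) (0 : R).
  apply: cvg_sum_seq => i; rewrite -[X in _ --> X](mulr0 0).
  by apply: cvgM.
rewrite z in h; rewrite (_ : (fun n => _) = fun n => \sum_i v n i 0 * v n i 0)//.
by apply/funext => n; rewrite dotvE.
Qed.

Lemma dotv_cvg0_coord v i : dotv (v n) (v n) @[n --> \oo] --> 0 ->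
  v n i 0 @[n --> \oo] --> 0.
Proof.
move=> vc; apply/cvgr0Pnorm_lt => eps eps0.
near=> n; have : dotv (v n) (v n) < eps ^+ 2.
  apply: le_lt_trans (ler_norm _) _; near: n.
  by apply: (cvgr0_norm_lt _ vc); rewrite exprn_gt0.
rewrite dotvE (bigD1 i)//= -expr2 -(real_normK (num_real (v n i 0))) => h.
rewrite -(@ltr_pXn2r _ 2) ?nnegrE// ?(ltW eps0)//.
apply: le_lt_trans h; rewrite lerDl sumr_ge0// => j _.
by rewrite -expr2 sqr_ge0.
Unshelve. all: by end_near. Qed.

(** Adding to [v] the tail [t] of the convergent series of the [delta] removes the
noise from the recursion, at the price of replacing the vanishing [f] by
[f + Q t], which vanishes too.  The squared norm of [y = v + t] is then
contracted by the factor [1 - k b / 2], [k] being the coercivity constant of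
[Q]. *)
Lemma stochastic_approximation_cvg0 (Q : 'M[R]_dim) b v f delta :
  Q^T = Q -> (forall u, 0 <= dotv u (Q *m u)) -> Q \in unitmx ->
  (forall n, 0 < b n) -> b n @[n --> \oo] --> 0 ->
  series b n @[n --> \oo] --> +oo ->
  (forall i, f n i 0 @[n --> \oo] --> 0) ->
  (forall i, cvgn (series (fun n => delta n i 0))) ->
  (forall n, v n.+1 = v n + b n *: (f n - Q *m v n) + delta n) ->
  forall i, v n i 0 @[n --> \oo] --> 0.
Proof.
move=> Qs Q0 Qu b0 bc bs fc dc rec.
have [k k0 kQ] := psd_unit_coercive Qs Q0 Qu.
have [L L0 LQ] := mulmx_bounded Q.
pose t n := \col_i (limn (series (fun n => delta n i 0)) - series (fun n => delta n i 0) n).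
have tc i : t n i 0 @[n --> \oo] --> 0.
  under eq_fun do rewrite mxE.
  rewrite -(subrr (limn (series (fun n => delta n i 0)))).
  by apply: cvgB; [exact: cvg_cst|exact: dc].
have trec n : t n.+1 = t n - delta n.
  by apply/colP => i; rewrite !mxE seriesSr; ring.
pose y n := v n + t n.
pose g n := f n + Q *m t n.
have yrec n : y n.+1 = y n + b n *: (g n - Q *m y n).
  have -> : g n - Q *m y n = f n - Q *m v n.
    by rewrite /g /y mulmxDr opprD addrACA subrr addr0.
  by rewrite /y rec trec -[LHS]addrA [delta n + _]addrCA subrr addr0 addrAC.
have dt := dotv_cvg0 tc.
have df := dotv_cvg0 fc.
have dg : dotv (g n) (g n) @[n --> \oo] --> 0.
  apply: (@squeeze_cvgr _ _ _ _ (fun=> 0) (fun n => 2 * dotv (f n) (f n) + 2 * (L * dotv (t n) (t n)))).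
  - near=> n; rewrite dotv_ge0/=; apply: le_trans (dotvD_le _ _) _.
    by rewrite lerD2l ler_wpM2l.
  - exact: cvg_cst.
  - by apply: cvg0_add; apply: cvg0_mull => //; exact: cvg0_mull.
have dy : dotv (y n) (y n) @[n --> \oo] --> 0.
  apply: (@contraction_cvg0 (k / 2) b (fun n => (2 / k + k) * dotv (g n) (g n))) => //.
  - by rewrite divr_gt0.
  - exact: cvg0_mull.
  - by move=> n; exact: dotv_ge0.
  near=> n.
  have bk : b n <= k / 2.
    apply: le_trans (ler_norm _) _; near: n.
    by apply: (cvgr0_norm_le _ bc); rewrite divr_gt0.
  rewrite yrec.
  (* Young's inequality bounds the cross term <y, g>, and the lower bound of
     <y, Q y> by |Q y|^2 absorbs the second order term as soon as b <= k / 2 *)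
  have [c1 c2] := kQ (y n).
  have young := dotv_ge0 ((k / 2) *: y n - g n).
  have := dotvD_le (g n) (- (Q *m y n)).
  move: young c1 c2 (dotv_ge0 (y n)) (dotv_ge0 (g n))
    (dotv_ge0 (Q *m y n)) (b0 n) bk.
  move: (y n) (g n) => {yrec dg} {}y {}g.
  rewrite !(dotvDl, dotvDr, dotvNl, dotvNr, dotvZl, dotvZr) (dotvC g y)
    (dotvC (Q *m y) y) (dotvC (Q *m y) g).
  move: (dotv y y) (dotv g g) (dotv y (Q *m y))
    (dotv (Q *m y) (Q *m y)) (dotv y g) (dotv g (Q *m y)) (b n)
    => A B C D F H bb.
  move=> young kA kD A0 B0 D0 bb0 bk E.
  have F2 : 2 * F <= k / 2 * A + 2 / k * B.
    rewrite -(ler_pM2l k0) (_ : k * (k / 2 * A + 2 / k * B) = k ^+ 2 / 2 * A + 2 * B).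
      nra.
    by field; rewrite gt_eqF.
  have h1 : bb * (2 * F) <= bb * (k / 2 * A + 2 / k * B) by rewrite ler_pM2l.
  have h2 : bb * (k * A) <= bb * C by rewrite ler_pM2l.
  have h3 : bb * (k * D) <= bb * C by rewrite ler_pM2l.
  have h4 : bb * (bb * D) <= bb * (k / 2 * D) by rewrite ler_pM2l// ler_wpM2r.
  have h5 : bb * (bb * B) <= bb * (k / 2 * B) by rewrite ler_pM2l// ler_wpM2r.
  have h6 : bb * (bb * (B - H + (- H - - D))) <= bb * (bb * (2 * B + 2 * - - D)).
    by rewrite !ler_pM2l.
  move: h1 h2 h3 h4 h5 h6; rewrite !opprK !(mulrDr, mulrDl) !(mulrN, mulNr).
  move: (2 / k) => K; lra.
move=> i; apply: dotv_cvg0_coord.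
apply: (@squeeze_cvgr _ _ _ _ (fun=> 0) (fun n => 2 * dotv (y n) (y n) + 2 * dotv (t n) (t n))).
- near=> n; rewrite dotv_ge0/=.
  have -> : v n = y n + - t n by rewrite addrK.
  by apply: le_trans (dotvD_le _ _) _; rewrite dotvNl dotvNr opprK.
- exact: cvg_cst.
- by apply: cvg0_add; apply: cvg0_mull.
Unshelve. all: by end_near. Qed.

End deterministic_recursions.

Section column_vectors.
Context (R : realType) (dim : nat).

Lemma le_entry_norm (x : 'cV[R]_dim) i : `|x i 0| <= `|x|.
Proof.
rewrite [`|x|]mx_normrE.
exact: (le_bigmax_cond _ (fun ij : 'I_dim * 'I_1 => `|x ij.1 ij.2|) (j := (i, 0))).
Qed.

(** The norm of a matrix is the maximum of the absolute values of its entries,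
hence it is dominated by the Euclidean one. *)
Lemma sqr_norm_le_dotv (x : 'cV[R]_dim) : `|x| ^+ 2 <= dotv x x.
Proof.
have [->|] := eqVneq `|x| 0; first by rewrite expr0n/= dotv_ge0.
move=> /mx_norm_neq0[[i j]]; rewrite -[mx_norm x]/`|x| /= => ->; rewrite (ord1 j) real_normK ?num_real//.
rewrite dotvE (bigD1 i)//= expr2 lerDl sumr_ge0// => k _.
by rewrite -expr2 sqr_ge0.
Qed.

Lemma cvg_colP (x : nat -> 'cV[R]_dim) (y : 'cV[R]_dim) :
  (forall i, x n i 0 @[n --> \oo] --> y i 0) -> x n @[n --> \oo] --> y.
Proof.
move=> xy; apply/cvgrPdist_lt => eps eps0.
have : dotv (y - x n) (y - x n) @[n --> \oo] --> (0 : R).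
  apply: (@dotv_cvg0 _ _ (fun n => y - x n)) => i.
  rewrite (_ : (fun n => _) = fun n => y i 0 - x n i 0); last by apply/funext => n; rewrite !mxE.
  by rewrite -(subrr (y i 0)); apply: cvgB; [exact: cvg_cst|exact: xy].
move=> /cvgr0Pnorm_lt /(_ (eps ^+ 2)); rewrite exprn_gt0// => /(_ isT).
apply: filterS => n; rewrite (ger0_norm (dotv_ge0 _)) => h.
by rewrite -(@ltr_pXn2r _ 2) ?nnegrE ?(ltW eps0)// (le_lt_trans (sqr_norm_le_dotv _)).
Qed.

End column_vectors.

(** * The two time scales along one trajectory *)

(** Here [xi] and [eta] gather the whole deviation of the two updates from their
averages; the only thing asked of them is the convergence of the series they
form with the step sizes.  [v] is the gap between the fast iterate and the value
[Ci (bv - Am theta)] at which its field vanishes, and [m] is the averaged field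
of the slow iterate. *)
Section tdc_pathwise.
Context (R : realType) (dim : nat).
Variables (Am Cm : 'M[R]_dim) (bv thstar : 'cV[R]_dim).
Variables (a b : nat -> R) (th w xi eta : nat -> 'cV[R]_dim).
Hypotheses (Cm_sym : Cm^T = Cm) (Cm_psd : forall u, 0 <= dotv u (Cm *m u))
  (Cm_unit : Cm \in unitmx) (Am_unit : Am \in unitmx)
  (thstarE : Am *m thstar = bv).
Hypotheses (a0 : forall n, 0 < a n) (b0 : forall n, 0 < b n)
  (ac : a n @[n --> \oo] --> 0) (bc : b n @[n --> \oo] --> 0)
  (a_sum : series a n @[n --> \oo] --> +oo)
  (b_sum : series b n @[n --> \oo] --> +oo)
  (ab_ratio : (a n / b n) @[n --> \oo] --> (0 : R)).
Variable B : R.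
Hypotheses (th_bnd : forall n, dotv (th n) (th n) <= B)
  (w_bnd : forall n, dotv (w n) (w n) <= B).
Hypotheses (xi_cvg : forall i, cvgn (series (fun n => a n * xi n i 0)))
  (eta_cvg : forall i, cvgn (series (fun n => b n * eta n i 0))).
Hypothesis th_rec : forall n, th n.+1 = th n +
  a n *: (bv - Am *m th n - (Cm - Am^T) *m w n + xi n).
Hypothesis w_rec : forall n, w n.+1 = w n +
  b n *: (bv - Am *m th n - Cm *m w n + eta n).

Let u n := th n - thstar.
Let Ci := invmx Cm.
Let v n := w n + Ci *m (Am *m u n).
Let m n := - (Am *m u n) - (Cm - Am^T) *m w n.

Let residual n : bv - Am *m th n = - (Am *m u n).
Proof. by rewrite /u mulmxBr thstarE opprB. Qed.

Let u_rec n : u n.+1 = u n + a n *: (m n + xi n).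
Proof. by rewrite /u th_rec addrAC -/(u n) residual. Qed.

(** The slow step moves the target of the fast iterate by
[Ci Am (a (m + xi))]; its drift, rewritten as [b (a / b) ..], is negligible in
front of the fast step, and its noise is summable. *)
Let v_rec n : v n.+1 = v n + b n *: ((a n / b n) *: (Ci *m (Am *m m n)) - Cm *m v n)
  + (b n *: eta n + Ci *m (Am *m (a n *: xi n))).
Proof.
have Cv : Cm *m v n = Cm *m w n + Am *m u n by rewrite /v mulmxDr mulKVmx.
rewrite Cv /v u_rec w_rec residual.
move: (m n) (u n) => mn un.
rewrite !(mulmxDr, scalerDr, scalerN, opprD) !scalerA mulrCA divff ?gt_eqF// mulr1.
rewrite -!scalemxAr.
move: (w n) (Ci *m (Am *m un)) (b n *: (Am *m un)) (b n *: (Cm *m w n)) (b n *: eta n)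
  (a n *: (Ci *m (Am *m mn))) (a n *: (Ci *m (Am *m xi n))) => x1 x2 x3 x4 x5 x6 x7.
by apply/colP => i; rewrite !mxE; ring.
Qed.

Let bounded_drift : exists2 D, 0 <= D &
  forall n, dotv (Ci *m (Am *m m n)) (Ci *m (Am *m m n)) <= D.
Proof.
have [L1 L10 L1P] := mulmx_bounded (Ci *m Am).
have [L2 L20 L2P] := mulmx_bounded Am.
have [L3 L30 L3P] := mulmx_bounded (Cm - Am^T).
have B0 : 0 <= B := le_trans (dotv_ge0 _) (th_bnd 0).
exists (L1 * (2 * (L2 * (2 * B + 2 * dotv thstar thstar)) + 2 * (L3 * B))).
  have t0 := dotv_ge0 thstar.
  apply: mulr_ge0; first exact: ltW.
  apply: addr_ge0; apply: mulr_ge0 => //; apply: mulr_ge0; rewrite ?(ltW L20) ?(ltW L30)//.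
  by apply: addr_ge0; exact: mulr_ge0.
move=> n; rewrite mulmxA; apply: le_trans (L1P _) _.
rewrite ler_wpM2l ?(ltW L10)//; apply: le_trans (dotvD_le _ _) _.
rewrite !(dotvNl, dotvNr) !opprK; apply: lerD; rewrite ler_wpM2l//.
  apply: le_trans (L2P _) _; rewrite ler_wpM2l ?(ltW L20)//.
  apply: le_trans (dotvD_le _ _) _; rewrite dotvNl dotvNr opprK lerD2r.
  by rewrite ler_wpM2l.
by apply: le_trans (L3P _) _; rewrite ler_wpM2l ?(ltW L30).
Qed.

Let noise_cvg i : cvgn (series (fun n => (b n *: eta n + Ci *m (Am *m (a n *: xi n))) i 0)).
Proof.
rewrite (_ : (fun n => _) = fun n => b n * eta n i 0 + \sum_k (Ci *m Am) i k * (a n * xi n k 0)).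
  by apply: cvgn_seriesD => //; apply: cvgn_series_sum => k; exact: cvgn_seriesZ.
apply/funext => n; rewrite mulmxA [LHS]mxE; congr (_ + _); first by rewrite mxE.
by rewrite [LHS]mxE; apply: eq_bigr => k _; congr (_ * _); rewrite mxE.
Qed.

Let v_cvg i : v n i 0 @[n --> \oo] --> 0.
Proof.
apply: (stochastic_approximation_cvg0 Cm_sym Cm_psd Cm_unit b0 bc b_sum _ noise_cvg v_rec).
move=> {}i; apply: dotv_cvg0_coord.
have [D D0 DP] := bounded_drift.
apply: (@squeeze_cvgr _ _ _ _ (fun=> 0) (fun n => D * (a n / b n * (a n / b n)))).
- near=> n; rewrite dotv_ge0/= dotvZl dotvZr mulrA [leRHS]mulrC ler_wpM2l//.
  by rewrite -expr2 sqr_ge0.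
- exact: cvg_cst.
- by apply: cvg0_mull; rewrite -[X in _ --> X](mulr0 0); exact: cvgM.
Unshelve. all: by end_near. Qed.

(** Substituting [w = v - Ci Am u] in [m] leaves [- Q u], up to a term in [v];
being congruent to [Ci], [Q] is positive definite. *)
Let Q := Am^T *m Ci *m Am.

Let Ci_sym : Ci^T = Ci.
Proof. by rewrite /Ci trmx_inv Cm_sym. Qed.

Lemma tdc_pathwise_cvg i : th n i 0 @[n --> \oo] --> thstar i 0.
Proof.
suff h : u n i 0 @[n --> \oo] --> 0.
  rewrite -[thstar i 0]add0r.
  rewrite (_ : (fun n => _) = fun n => u n i 0 + thstar i 0).
    by apply: cvgD => //; exact: cvg_cst.
  by apply/funext => n; rewrite /u !mxE subrK.
move: i.
apply: (@stochastic_approximation_cvg0 _ _ Q a u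
  (fun n => - ((Cm - Am^T) *m v n)) (fun n => a n *: xi n)) => //.
- by rewrite /Q !trmx_mul trmxK Ci_sym mulmxA.
- move=> x; rewrite /Q -!mulmxA dotv_mulmx trmxK.
  rewrite (_ : dotv _ _ = dotv (Ci *m (Am *m x)) (Cm *m (Ci *m (Am *m x)))) ?Cm_psd//.
  by rewrite mulKVmx// dotvC.
- by rewrite /Q !unitmx_mul unitmx_tr Am_unit unitmx_inv Cm_unit.
- move=> i; rewrite (_ : (fun n => _) = fun n => \sum_k (- (Cm - Am^T) i k) * v n k 0).
    have h : (\sum_k (- (Cm - Am^T) i k) * v n k 0) @[n --> \oo] --> \sum_(k < dim) (0 : R).
      by apply: cvg_sum_seq => k; apply: cvg0_mull.
    by rewrite big1 in h.
  apply/funext => n; rewrite -mulNmx [LHS]mxE; apply: eq_bigr => k _.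
  by congr (_ * _); rewrite mxE.
- move=> i; rewrite (_ : (fun n => _) = fun n => a n * xi n i 0)//.
  by apply/funext => n; rewrite mxE.
- move=> n; rewrite u_rec scalerDr addrA; congr (_ + _ *: _ + _).
  have E : (Cm - Am^T) *m (Ci *m (Am *m u n)) = Am *m u n - Q *m u n.
    by rewrite mulmxBl mulKVmx// /Q !mulmxA.
  rewrite /m /v [_ *m (w n + _)]mulmxDr E.
  move: (_ *m w n) (Am *m u n) (Q *m u n) => x1 x2 x3.
  by apply/colP => i; rewrite !mxE; ring.
Qed.

End tdc_pathwise.

(** * The Poisson equation of an irreducible chain *)

Section poisson_equation.
Context (R : realType) (S : finType) (K : S -> S -> R) (nu : S -> R).
Hypotheses (K0 : forall s s', 0 <= K s s') (K1 : forall s, \sum_s' K s s' = 1).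
Hypothesis K_irr : irreducible_kernel K.
Hypothesis nu_stat : stationary K nu.

Lemma nstep_ge0 n s s' : 0 <= nstep K n s s'.
Proof.
elim: n s => [|n IH] s /=; first exact: ler0n.
by apply: sumr_ge0 => u _; rewrite mulr_ge0.
Qed.

Lemma nstep_sum1 n s : \sum_s' nstep K n s s' = 1.
Proof.
elim: n s => [|n IH] s /=.
  by rewrite (bigD1 s)//= eqxx big1 ?addr0// => u us; rewrite eq_sym (negbTE us).
by rewrite exchange_big/= -[RHS](K1 s); apply: eq_bigr => u _; rewrite -mulr_sumr IH mulr1.
Qed.

Lemma harmonic_nstep (f : S -> R) : (forall s, f s = \sum_u K s u * f u) ->
  forall n s, f s = \sum_u nstep K n s u * f u.
Proof.
move=> fK; elim=> [|n IH] s /=.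
  rewrite (bigD1 s)//= eqxx mul1r big1 ?addr0// => u us.
  by rewrite eq_sym (negbTE us) mul0r.
under eq_bigr do rewrite mulr_suml.
rewrite exchange_big/= fK; apply: eq_bigr => u _.
by rewrite IH mulr_sumr; apply: eq_bigr => t _; rewrite mulrA.
Qed.

(** Maximum principle: at a maximum [m] of [f], [f m] is an average of the values
of [f], so that [f] equals [f m] at each state charged by some power of the
kernel, that is, everywhere. *)
Lemma harmonic_constant (f : S -> R) : (forall s, f s = \sum_u K s u * f u) ->
  forall s s', f s = f s'.
Proof.
move=> fK s s'.
pose m := [arg max_(t > s) f t]%O.
have fm t : f t <= f m by rewrite /m; case: arg_maxP => // i _; apply.
suff fE t : f t = f m by rewrite !fE.
have [n nt] := K_irr m t.
have z : \sum_u nstep K n m u * (f m - f u) = 0.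
  under eq_bigr do rewrite mulrBr.
  by rewrite sumrB -mulr_suml nstep_sum1 mul1r -harmonic_nstep// subrr.
have /eqP := z; rewrite psumr_eq0; last first.
  by move=> u _; rewrite mulr_ge0 ?nstep_ge0// subr_ge0.
move=> /allP /(_ t (mem_index_enum _)) /=.
by rewrite mulf_eq0 (gt_eqF nt)/= subr_eq0 => /eqP.
Qed.

Let sum_enum_val (F : S -> R) : \sum_(j < #|S|) F (enum_val j) = \sum_u F u.
Proof. by rewrite -(big_enum_val F). Qed.

(** The matrix [I - K + 1 nu] is invertible: if it kills [f] then applying [nu],
which kills [I - K], gives [nu f = 0]; hence [f] is harmonic, constant, and
zero.  The same application of [nu] shows that the preimage [V] of
[h - nu h] has mean zero, so that the correction [1 nu] disappears. *)
Lemma poisson_solution (h : S -> R) : exists V : S -> R,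
  forall s, V s - \sum_u K s u * V u = h s - \sum_u nu u * h u.
Proof.
have [[nu0 nu1] nuK] := nu_stat.
pose M : 'M[R]_#|S| := \matrix_(i, j)
  ((i == j)%:R - K (enum_val i) (enum_val j) + nu (enum_val j)).
have ME (f : S -> R) s : \sum_j M (enum_rank s) j * f (enum_val j) =
    f s - \sum_u K s u * f u + \sum_u nu u * f u.
  under eq_bigr do rewrite mxE enum_rankK mulrDl mulrBl.
  rewrite big_split/= sumrB; congr (_ - _ + _).
  - rewrite (bigD1 (enum_rank s))//= eqxx mul1r enum_rankK big1 ?addr0// => j js.
    by rewrite eq_sym (negbTE js) mul0r.
  - exact: (sum_enum_val (fun u => K s u * f u)).
  - exact: (sum_enum_val (fun u => nu u * f u)).
have nuP (f : S -> R) : \sum_s nu s * (f s - \sum_u K s u * f u) = 0.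
  under eq_bigr do rewrite mulrBr mulr_sumr.
  rewrite sumrB exchange_big/=.
  under [X in _ - X]eq_bigr => u _.
    under eq_bigr do rewrite mulrA.
    rewrite -mulr_suml nuK.
    over.
  by rewrite subrr.
have Mu : M \in unitmx.
  rewrite -unitmx_tr -row_free_unit; apply: inj_row_free => v vM.
  pose f s := v 0 (enum_rank s).
  have fE s : f s - \sum_u K s u * f u + \sum_u nu u * f u = 0.
    rewrite -ME; transitivity ((v *m M^T) 0 (enum_rank s)); last by rewrite vM mxE.
    rewrite [RHS]mxE; apply: eq_bigr => j _; by rewrite /f enum_valK [RHS]mulrC [M^T _ _]mxE.
  have nuf : \sum_u nu u * f u = 0.
    have : \sum_s nu s * (f s - \sum_u K s u * f u + \sum_u nu u * f u) = 0.
      by rewrite big1// => s _; rewrite fE mulr0.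
    under eq_bigr do rewrite mulrDr.
    by rewrite big_split/= nuP add0r -mulr_suml nu1 mul1r.
  have fharm s : f s = \sum_u K s u * f u.
    by apply/eqP; rewrite -subr_eq0; have := fE s; rewrite nuf addr0 => ->.
  have f0 s : f s = 0.
    rewrite -nuf; under eq_bigr => u _ do rewrite (harmonic_constant fharm u s).
    by rewrite -mulr_suml nu1 mul1r.
  by apply/rowP => j; rewrite mxE; have := f0 (enum_val j); rewrite /f enum_valK.
pose g s := h s - \sum_u nu u * h u.
pose y : 'cV[R]_#|S| := invmx M *m \col_i g (enum_val i).
pose V s := y (enum_rank s) 0.
have VE s : V s - \sum_u K s u * V u + \sum_u nu u * V u = g s.
  rewrite -ME.
  have : M *m y = \col_i g (enum_val i) by rewrite mulKVmx.
  move=> /colP /(_ (enum_rank s)); rewrite [LHS]mxE [RHS]mxE enum_rankK => <-.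
  by apply: eq_bigr => j _; rewrite /V enum_valK.
exists V => s.
have nuV : \sum_u nu u * V u = 0.
  have : \sum_s nu s * (V s - \sum_u K s u * V u + \sum_u nu u * V u) = \sum_s nu s * g s.
    by apply: eq_bigr => t _; rewrite VE.
  under eq_bigr do rewrite mulrDr.
  rewrite big_split/= nuP add0r -mulr_suml nu1 mul1r => ->.
  under eq_bigr do rewrite /g mulrBr.
  by rewrite sumrB -mulr_suml nu1 mul1r subrr.
by have := VE s; rewrite nuV addr0.
Qed.

End poisson_equation.

(** * Integrating a variable against its conditional law *)

Section restricted_measure.
Context d (T : measurableType d) (R : realType).
Variables (mu : {measure set T -> \bar R}) (D : set T) (mD : measurable D).
Local Open Scope ereal_scope.

Lemma ge0_integral_mrestr (f : T -> \bar R) : measurable_fun [set: T] f ->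
  (forall x, 0 <= f x) ->
  \int[mrestr mu mD]_x f x = \int[mu]_(x in D) f x.
Proof.
move=> mf f0.
rewrite [LHS](@ge0_negligible_integral _ _ _ _ _ (~` D))//=.
- rewrite setTD setCK; apply: eq_measure_integral => A mA AD /=.
  by rewrite /mrestr setIidl.
- exact: measurableC.
- by rewrite /mrestr setICl measure0.
Qed.

Lemma integrable_mrestr (f : T -> \bar R) : measurable_fun [set: T] f ->
  mu.-integrable D f -> (mrestr mu mD).-integrable setT f.
Proof.
move=> mf /integrableP[_ fi]; apply/integrableP; split => //.
by rewrite ge0_integral_mrestr//; exact: measurableT_comp.
Qed.

Lemma integral_mrestr (f : T -> \bar R) : measurable_fun [set: T] f ->
  \int[mrestr mu mD]_x f x = \int[mu]_(x in D) f x.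
Proof.
move=> mf; rewrite [LHS]integralE [RHS]integralE.
rewrite !ge0_integral_mrestr//.
- exact: measurable_funeneg.
- exact: measurable_funepos.
Qed.

Lemma integral_mscale_EFin (c : {nonneg R}) (f : T -> \bar R) :
  mu.-integrable setT f ->
  \int[mscale c mu]_x f x = c%:num%:E * \int[mu]_x f x.
Proof.
move=> fi; have mf := measurable_int _ fi.
rewrite [LHS]integralE [in RHS]integralE.
rewrite !ge0_integral_mscale//; last 2 first.
- exact: measurable_funeneg.
- exact: measurable_funepos.
by rewrite [RHS]muleBr//; exact: (integrable_add_def measurableT).
Qed.

End restricted_measure.

(** [lawZ] says that on the event [D] the variable [Z] has law [Q] and is
independent of the sigma-algebra generated by [G], the mass of [D] given the past
being [c] on [D'].  Equivalently, the image of [P] restricted to [D] under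
[w |-> (w, Z w)], the first component being observed through [G] only, is the
product of [Q] and of the measure [c P] restricted to [D']; integrals are then
computed by Fubini. *)
Section conditional_law.
Context d (T : measurableType d) (R : realType) (P : probability T R).
Variables (G : set (set T)) (D D' : set T) (Z : T -> R).
Variables (Q : probability R R) (c : {nonneg R}).
Hypotheses (GT : <<s G>> `<=` measurable) (mD : measurable D)
  (mD' : measurable D') (mZ : measurable_fun [set: T] Z).
Hypothesis lawZ : forall E B, <<s G>> E -> measurable B ->
  P (E `&` (D `&` Z @^-1` B)) = (P (E `&` D') * c%:num%:E * Q B)%E.
Local Open Scope ereal_scope.

Let T' := g_sigma_algebraType G.

(** The identity, seen as a measurable map to the coarser sigma-algebra: pushing
a measure forward along it restricts the measure to the past. *)
Let into : T -> T' := fun w => w.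

Let measurable_into : measurable_fun [set: T] into.
Proof. by move=> _ B mB; rewrite setTI; exact: GT. Qed.

Let joint : T -> T' * R := fun w => (into w, Z w).

Let measurable_joint : measurable_fun [set: T] joint.
Proof. exact: measurable_fun_pair. Qed.

Let pushed : {measure set T' -> \bar R} :=
  measure_function_pushforward__canonical__measure_function_Measure
    (mscale c (mrestr P mD')) measurable_into.

Let m1 : set T' -> \bar R := pushed.

HB.instance Definition _ := isMeasure.Build _ _ _ m1
  (measure0 pushed) (measure_ge0 pushed) (@measure_semi_sigma_additive _ _ _ pushed).

Let m1_fin : fin_num_fun m1.
Proof. by move=> A mA; apply: fin_num_measure; exact: GT. Qed.

HB.instance Definition _ := Measure_isFinite.Build _ _ _ m1 m1_fin.

Let mP : {measure set (T' * R) -> \bar R} :=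
  measure_function_pushforward__canonical__measure_function_Measure
    (mrestr P mD) measurable_joint.

Let joint_law A : measurable A -> (m1 \x Q) A = mP A.
Proof.
apply: product_measure_unique => E B mE mB.
transitivity (P (E `&` (D `&` Z @^-1` B))); last first.
  by rewrite lawZ//; congr (_ * _); exact: muleC.
congr (P _); rewrite /joint /into; apply/seteqP; split => w /=; tauto.
Qed.

Let ge0_integral_joint (F : T' * R -> \bar R) :
  measurable_fun [set: T' * R] F -> (forall x, 0 <= F x) ->
  \int[P]_(w in D) F (joint w) =
  c%:num%:E * \int[P]_(w in D') \int[Q]_x F (into w, x).
Proof.
move=> mF F0.
rewrite -(ge0_integral_mrestr P mD)//; last exact: measurableT_comp.
rewrite -[LHS](@ge0_integral_pushforward _ _ _ _ _ _ measurable_joint (mrestr P mD) setT)//.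
rewrite (@eq_measure_integral _ _ _ _ (m1 \x Q)); last first.
  by move=> A mA _; exact/esym/joint_law.
rewrite fubini_tonelli1//.
have mG := measurable_fun_fubini_tonelli_F F mF F0.
rewrite (@ge0_integral_pushforward _ _ _ _ _ _ measurable_into
  (mscale c (mrestr P mD')) setT)//; last first.
  by move=> y _; apply: integral_ge0.
rewrite preimage_setT ge0_integral_mscale//; last first.
- by move=> y _; apply: integral_ge0.
- exact: measurableT_comp.
rewrite ge0_integral_mrestr//.
- exact: measurableT_comp.
- by move=> y; apply: integral_ge0.
Qed.

Let integral_joint (F : T' * R -> \bar R) :
  measurable_fun [set: T' * R] F ->
  P.-integrable D (F \o joint) ->
  \int[P]_(w in D) F (joint w) = \int[m1]_w \int[Q]_x F (w, x).
Proof.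
move=> mF Fi.
have mFj : measurable_fun [set: T] (F \o joint) by exact: measurableT_comp.
rewrite -(integral_mrestr P mD)//.
have Fi' := integrable_mrestr mD mFj Fi.
rewrite -[LHS](@integral_pushforward _ _ _ _ _ _ measurable_joint (mrestr P mD) setT)//.
have jE : forall A, measurable A -> mP A = (m1 \x Q) A.
  by move=> A mA; exact/esym/joint_law.
rewrite (@eq_measure_integral _ _ _ _ (m1 \x Q)); last by move=> A mA _; exact: jE.
rewrite -integral12_prod_meas1//.
apply/integrableP; split => //.
rewrite -(@eq_measure_integral _ _ _ _ (m1 \x Q) mP); last by move=> A mA _; exact: jE.
have /integrableP[_] := @integrable_pushforward _ _ _ _ _ _ measurable_joint
  (mrestr P mD) setT F mF Fi' measurableT.
by [].
Qed.

Lemma ge0_integral_cond_law (h : T -> R) (g : R -> R) :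
  measurable_fun [set: T'] h -> measurable_fun [set: R] g ->
  (forall w, (0 <= h w)%R) -> (forall x, (0 <= g x)%R) ->
  \int[P]_(w in D) (h w * g (Z w))%:E =
  c%:num%:E * \int[P]_(w in D') (h w)%:E * \int[Q]_x (g x)%:E.
Proof.
move=> mh mg h0 g0.
rewrite (@ge0_integral_joint (fun z => (h z.1 * g z.2)%:E)); first last.
- by move=> x; rewrite lee_fin mulr_ge0.
- apply/measurable_EFinP; apply: measurable_funM.
  + exact: (measurableT_comp mh measurable_fst).
  + exact: (measurableT_comp mg measurable_snd).
rewrite -muleA; congr (_ * _).
have mh' : measurable_fun D' h.
  by apply: measurable_funTS; exact: (measurableT_comp mh measurable_into).
rewrite -ge0_integralZr//.
- apply: eq_integral => w _ /=.
  under eq_integral do rewrite EFinM.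
  by rewrite ge0_integralZl//; [exact/measurable_EFinP|move=> x _; rewrite lee_fin|rewrite lee_fin].
- exact/measurable_EFinP.
- by move=> x _; rewrite lee_fin.
- by apply: integral_ge0 => x _; rewrite lee_fin.
Qed.

Lemma integral_cond_law (h : T -> R) (g : R -> R) (M : R) :
  measurable_fun [set: T'] h -> (forall w, (`|h w| <= M)%R) ->
  Q.-integrable setT (EFin \o g) ->
  P.-integrable D (fun w => (h w * g (Z w))%:E) /\
  \int[P]_(w in D) (h w * g (Z w))%:E =
  c%:num%:E * \int[P]_(w in D') (h w)%:E * \int[Q]_x (g x)%:E.
Proof.
move=> mh hM gi.
have mg : measurable_fun [set: R] g by apply/measurable_EFinP; exact: measurable_int gi.
have mhT : measurable_fun [set: T] h by exact: (measurableT_comp mh measurable_into).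
have mprod : measurable_fun [set: T' * R] (fun z => (h z.1 * g z.2)%:E).
  apply/measurable_EFinP; apply: measurable_funM.
  + exact: (measurableT_comp mh measurable_fst).
  + exact: (measurableT_comp mg measurable_snd).
have hi (mu : {finite_measure set T -> \bar R}) : mu.-integrable setT (EFin \o h).
  apply: measurable_bounded_integrable => //; first exact: fin_num_fun_lty.
  exists M; split; first exact: num_real.
  by move=> x Mx y _ /=; apply: le_trans (hM _) (ltW Mx).
have I : P.-integrable D (fun w => (h w * g (Z w))%:E).
  apply/integrableP; split.
    by apply: measurable_funTS; exact: (measurableT_comp mprod measurable_joint).
  under eq_integral do rewrite /= normrM.
  rewrite (@ge0_integral_cond_law (fun w => `|h w|)%R (fun w => `|g w|)%R)//; last 2 first.
  - exact: measurableT_comp.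
  - exact: measurableT_comp.
  have /integrableP[_ gfin] := gi.
  have /integrableP[_ hfin] := integrableS measurableT mD' (@subsetT _ _) (hi P).
  rewrite -ge0_fin_numE; last first.
    apply: mule_ge0; last by apply: integral_ge0.
    by apply: mule_ge0 => //; apply: integral_ge0.
  rewrite !fin_numM// ge0_fin_numE//; by [|apply: integral_ge0].
split=> //.
rewrite (@integral_joint (fun z => (h z.1 * g z.2)%:E))//.
have gfin : \int[Q]_x (g x)%:E \is a fin_num by exact: integrable_fin_num.
rewrite -(fineK gfin).
transitivity (\int[m1]_w ((h w)%:E * (fine (\int[Q]_x (g x)%:E))%:E)).
  apply: eq_integral => w _ /=.
  under eq_integral do rewrite EFinM.
  by rewrite integralZl// fineK.
set k := fine _.
have mhk : measurable_fun [set: T'] (fun w => (h w)%:E * k%:E).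
  by apply: emeasurable_funM => //; exact/measurable_EFinP.
have hki (mu : {finite_measure set T -> \bar R}) :
  mu.-integrable setT (fun w => (h w)%:E * k%:E).
  exact: (integrableZr measurableT k (hi mu)).
rewrite [LHS](@integral_pushforward _ _ _ _ _ _ measurable_into
  (mscale c (mrestr P mD')) setT)//; last exact: hki.
rewrite preimage_setT integral_mscale_EFin; last exact: hki.
rewrite integral_mrestr; last exact: measurable_int (hki P).
rewrite -muleA -integralZr//.
exact: integrableS measurableT mD' (@subsetT _ _) (hi P).
Qed.

End conditional_law.

(** * Convergence of square integrable martingales *)

Section prelim.
Context d (T : measurableType d) (R : realType).

Lemma measurable_fun_coarser (G1 G2 : set (set T)) (f : T -> R) :
  <<s G1>> `<=` <<s G2>> ->
  measurable_fun [set: g_sigma_algebraType G1] f ->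
  measurable_fun [set: g_sigma_algebraType G2] f.
Proof. by move=> G12 mf _ B mB; apply: G12; exact: mf. Qed.

Lemma measurable_fun_ambient (G1 : set (set T)) (f : T -> R) :
  <<s G1>> `<=` measurable ->
  measurable_fun [set: g_sigma_algebraType G1] f -> measurable_fun [set: T] f.
Proof. by move=> G1T mf _ B mB; apply: G1T; exact: mf. Qed.

Lemma square_integrable_integrable (P : probability T R) (f : T -> R) : measurable_fun [set: T] f ->
  P.-integrable setT (fun w => (f w ^+ 2)%:E) -> P.-integrable setT (EFin \o f).
Proof.
move=> mf f2.
apply: (@le_integrable _ _ _ _ _ _ _ (fun w => (1 + f w ^+ 2)%:E)) => //.
- exact/measurable_EFinP.
- move=> w _ /=; rewrite lee_fin [leRHS]ger0_norm; last by rewrite addr_ge0// sqr_ge0.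
  have := sqr_ge0 (`|f w| - 1); rewrite -[f w ^+ 2]real_normK ?num_real//.
  have := normr_ge0 (f w); nra.
- under eq_fun do rewrite EFinD.
  apply: integrableD => //.
  by apply: (@finite_measure_integrable_cst _ _ _ P setT 1).
Qed.

End prelim.

Section stopped_sums.
Context d (T : measurableType d) (R : realType) (P : probability T R).
Variables (G : nat -> set (set T)) (D : nat -> T -> R) (v : nat -> R) (e : R).
Hypothesis GT : forall n, <<s G n>> `<=` measurable.
Hypothesis Gmono : forall n, <<s G n>> `<=` <<s G n.+1>>.
Hypothesis mD : forall n, measurable_fun [set: g_sigma_algebraType (G n.+1)] (D n).
Hypothesis Dv : forall n, (\int[P]_w (D n w ^+ 2)%:E <= (v n)%:E)%E.
Hypothesis D0 : forall n (h : T -> R) (M : R),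
  measurable_fun [set: g_sigma_algebraType (G n)] h ->
  (forall w, `|h w| <= M) -> (\int[P]_w (h w * D n w)%:E = 0)%E.
Hypothesis e0 : 0 < e.

(** The partial sums of [D], frozen as soon as they leave the open interval of
radius [e].  An overshoot at any time is thus visible at every later time, and a
maximal inequality reduces to Chebyshev's inequality at the final time. *)
Fixpoint stopped n (w : T) : R :=
  if n is m.+1 then
    if `|stopped m w| < e then stopped m w + D m w else stopped m w
  else 0.

Let measurable_stopped n :
  measurable_fun [set: g_sigma_algebraType (G n)] (stopped n).
Proof.
elim: n => [|n IH] /=; first exact: measurable_cst.
have IH' := measurable_fun_coarser (@Gmono n) IH.
apply: measurable_fun_ifT => //.
- by apply: measurable_fun_ltr => //; exact: measurableT_comp.
- exact: measurable_funD.
Qed.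

Let mDT n : measurable_fun [set: T] (D n).
Proof. exact: (measurable_fun_ambient (@GT n.+1) (@mD n)). Qed.

Let mST n : measurable_fun [set: T] (stopped n).
Proof. exact: (measurable_fun_ambient (@GT n) (@measurable_stopped n)). Qed.

Let D2i n : P.-integrable setT (fun w => (D n w ^+ 2)%:E).
Proof.
apply/integrableP; split; first by apply/measurable_EFinP; exact: measurable_funX.
under eq_integral do rewrite gee0_abs ?lee_fin ?sqr_ge0//.
exact: le_lt_trans (Dv n) (ltry _).
Qed.

Let stopped_le n : P.-integrable setT (fun w => (stopped n w ^+ 2)%:E) /\
  (\int[P]_w (stopped n w ^+ 2)%:E <= (\sum_(i < n) v i)%:E)%E.
Proof.
elim: n => [|n [IHi IH]].
  split; first by under eq_fun do rewrite /= expr0n/=; exact: integrable0.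
  by rewrite big_ord0; under eq_integral do rewrite /= expr0n/=; rewrite integral0.
(* The multiplier of D n in the cross term of the expanded square: freezing makes
   it bounded by e, so the centering hypothesis applies to it. *)
pose h w := if `|stopped n w| < e then stopped n w else 0.
have mh : measurable_fun [set: g_sigma_algebraType (G n)] h.
  apply: measurable_fun_ifT => //.
  by apply: measurable_fun_ltr => //; exact: measurableT_comp.
have he w : `|h w| <= e.
  by rewrite /h; case: ifPn => [/ltW//|_]; rewrite normr0 ltW.
have mhT := measurable_fun_ambient (@GT _) mh.
have hDi : P.-integrable setT (EFin \o (fun w => 2 * (h w * D n w))).
  apply: (@eq_integrable _ _ _ _ _ _ (fun w => 2%:E * ((h w)%:E * (D n w)%:E))%E) => //.
  apply: (integrableZl measurableT); apply: (integrableMr measurableT) => //.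
    exists e; split; first exact: num_real.
    by move=> x ex w _ /=; exact: le_trans (he w) (ltW ex).
  exact: square_integrable_integrable.
have Si : P.-integrable setT
    (EFin \o (fun w => stopped n w ^+ 2 + 2 * (h w * D n w))).
  by apply: (integrableD measurableT IHi hDi).
have Ii : P.-integrable setT (EFin \o (fun w =>
    (stopped n w ^+ 2 + 2 * (h w * D n w)) + D n w ^+ 2)).
  by apply: (integrableD measurableT Si (D2i n)).
have le w : stopped n.+1 w ^+ 2 <=
    stopped n w ^+ 2 + 2 * (h w * D n w) + D n w ^+ 2.
  rewrite /= /h; case: ifPn => _; first by rewrite le_eqVlt; apply/orP; left; apply/eqP; ring.
  by rewrite mul0r mulr0 addr0 lerDl sqr_ge0.
have i1 : P.-integrable setT (fun w => (stopped n.+1 w ^+ 2)%:E).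
  apply: (le_integrable measurableT _ _ Ii).
    by apply/measurable_EFinP; apply: measurable_funX; exact: mST.
  move=> w _; rewrite lee_fin ger0_norm ?sqr_ge0//.
  by apply: le_trans (le w) _; exact: ler_norm.
split => //.
apply: (@le_trans _ _ (\int[P]_w (stopped n w ^+ 2 + 2 * (h w * D n w) + D n w ^+ 2)%:E)%E).
  by apply: le_integral => // w _; rewrite lee_fin.
have -> : (\int[P]_w (stopped n w ^+ 2 + 2 * (h w * D n w) + D n w ^+ 2)%:E
  = \int[P]_w (stopped n w ^+ 2)%:E + \int[P]_w (2 * (h w * D n w))%:E +
    \int[P]_w (D n w ^+ 2)%:E)%E.
  rewrite [LHS](integralD_EFin measurableT Si (D2i n)); congr (_ + _)%E.
  exact: (integralD_EFin measurableT IHi hDi).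
have -> : (\int[P]_w (2 * (h w * D n w))%:E = 0)%E.
  under eq_integral do rewrite mulrA.
  apply: (@D0 n (fun w => 2 * h w) (2 * e)).
    exact: measurable_funM.
  by move=> w; rewrite normrM ger0_norm// ler_pM2l.
by rewrite adde0 big_ord_recr/= EFinD leeD.
Qed.

Let stopped_prob n :
  (P [set w | (e <= `|stopped n w|)%R] <= ((\sum_(i < n) v i) / e ^+ 2)%:E)%E.
Proof.
have [Ii I] := stopped_le n.
rewrite EFinM muleC lee_pdivlMl ?exprn_gt0//.
apply: le_trans I.
have e20 : 0 < e ^+ 2 by rewrite exprn_gt0.
have mS2 : measurable_fun [set: T] (fun w => (stopped n w ^+ 2)%:E).
  by apply/measurable_EFinP; apply: measurable_funX; exact: mST.
have := le_integral_abse P measurableT mS2 e20.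
under eq_integral do rewrite gee0_abs ?lee_fin ?sqr_ge0//.
apply: le_trans; rewrite le_eqVlt; apply/orP; left; apply/eqP; congr (_ * P _)%E.
rewrite setTI; apply/seteqP; split => w /=;
  rewrite lee_fin (ger0_norm (sqr_ge0 _)) -(real_normK (num_real (stopped n w)));
  by rewrite ler_pXn2r// nnegrE ltW.
Qed.

Let measurable_overshoot n : measurable [set w | e <= `|stopped n w|].
Proof.
rewrite -[X in measurable X]setTI.
apply: (@measurable_fun_le _ _ _ _ (fun=> e) (fun w => `|stopped n w|)) => //.
by apply: measurableT_comp => //; exact: mST.
Qed.

Let stopped_nd :
  {homo (fun n => [set w | e <= `|stopped n w|]) : n m / (n <= m)%N >-> (n <= m)%O}.
Proof.
apply/nondecreasing_seqP => n; apply/subsetPset => w /=.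
by move=> ew; rewrite ltNge ew.
Qed.

Lemma measurable_overshoot_ever : measurable (\bigcup_n [set w | e <= `|stopped n w|]).
Proof. exact: bigcupT_measurable. Qed.

(** Kolmogorov's maximal inequality, over an infinite horizon. *)
Lemma overshoot_ever_le B : (forall n, \sum_(i < n) v i <= B) ->
  (P (\bigcup_n [set w | (e <= `|stopped n w|)%R]) <= (B / e ^+ 2)%:E)%E.
Proof.
move=> vB.
have h := nondecreasing_cvg_mu (mu := P) measurable_overshoot measurable_overshoot_ever stopped_nd.
have <- := cvg_lim (@ereal_hausdorff _) h.
apply: lime_le; first by apply/cvg_ex; eexists; exact: h.
near=> n; apply: le_trans (stopped_prob n) _.
by rewrite lee_fin ler_pM2r ?invr_gt0 ?exprn_gt0.
Unshelve. all: by end_near. Qed.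

Lemma overshoot_sum n w : e <= `|\sum_(i < n) D i w| ->
  (\bigcup_n [set w | e <= `|stopped n w|]) w.
Proof.
apply: contraPP => H; apply/negP; rewrite -ltNge.
have lt k : `|stopped k w| < e.
  by rewrite ltNge; apply/negP => ?; apply: H; exists k.
rewrite (_ : \sum_(i < n) D i w = stopped n w)//.
elim: n => [|n IH]; first by rewrite big_ord0.
by rewrite big_ord_recr/= IH lt.
Qed.

End stopped_sums.

Section martingale_convergence.
Context d (T : measurableType d) (R : realType) (P : probability T R).
Variables (G : nat -> set (set T)) (D : nat -> T -> R) (v : nat -> R).
Hypothesis GT : forall n, <<s G n>> `<=` measurable.
Hypothesis Gmono : forall n, <<s G n>> `<=` <<s G n.+1>>.
Hypothesis mD : forall n, measurable_fun [set: g_sigma_algebraType (G n.+1)] (D n).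
Hypothesis Dv : forall n, (\int[P]_w (D n w ^+ 2)%:E <= (v n)%:E)%E.
Hypothesis D0 : forall n (h : T -> R) (M : R),
  measurable_fun [set: g_sigma_algebraType (G n)] h ->
  (forall w, `|h w| <= M) -> (\int[P]_w (h w * D n w)%:E = 0)%E.
Hypothesis v_cvg : cvgn (series v).

Let v0 n : 0 <= v n.
Proof.
rewrite -lee_fin; apply: le_trans (Dv n).
by apply: integral_ge0 => w _; rewrite lee_fin sqr_ge0.
Qed.

Let bad (e : R) m := \bigcup_n
  [set w | e <= `|stopped (fun i => D (m + i)%N) e n w|].

Let bad_le e m : 0 < e ->
  (P (bad e m) <= ((limn (series v) - series v m) / e ^+ 2)%:E)%E.
Proof.
move=> e0.
apply: (@overshoot_ever_le _ _ _ P (fun i => G (m + i)%N) _ (fun i => v (m + i)%N)) => //.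
- by move=> n; rewrite addnS.
- by move=> n; rewrite addnS.
- by move=> n h M; exact: D0.
move=> n; rewrite lerBrDl.
apply: (@le_trans _ _ (series v (m + n)%N)); last first.
  apply: nondecreasing_cvgn_le => //.
  by apply: nondecreasing_series => k _ _; exact: v0.
rewrite /series/= [leRHS](@big_cat_nat _ _ _ m)//= ?leq_addr// lerD2l.
by rewrite -{2}[m]add0n big_addn addKn big_mkord; under eq_bigr do rewrite addnC.
Qed.

(** The partial sums oscillate by at least [1 / (j + 1)] after every time [m]
only on the intersection over [m] of the events [bad], whose probabilities are
bounded by the tails of the convergent series [v]; outside the union over [j] of
these negligible sets the partial sums form a Cauchy sequence. *)
Lemma martingale_series_cvg : {ae P, forall w, cvgn (series (fun n => D n w))}.
Proof.
pose N j := \bigcap_m bad (j.+1%:R^-1) m.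
have mbad e m : measurable (bad e m).
  apply: (@measurable_overshoot_ever _ _ _ (fun i => G (m + i)%N)) => //.
  - by move=> n; rewrite addnS.
  - by move=> n; rewrite addnS.
have mN j : measurable (N j) by exact: bigcapT_measurable.
have N0 j : P (N j) = 0%E.
  apply/eqP; rewrite eq_le measure_ge0 andbT.
  set e : R := j.+1%:R^-1; have e0 : 0 < e by rewrite invr_gt0.
  have PN m : (P (N j) <= ((limn (series v) - series v m) / e ^+ 2)%:E)%E.
    apply: le_trans (bad_le m e0); apply: le_measure; rewrite ?inE//.
    by move=> w; apply.
  have cv : (limn (series v) - series v m) / e ^+ 2 @[m --> \oo] --> (0 : R).
    rewrite -(mul0r (e ^+ 2)^-1) -(subrr (limn (series v))).
    apply: cvgM; last exact: cvg_cst.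
    by apply: cvgB; [exact: cvg_cst|exact: v_cvg].
  have PNfin : P (N j) \is a fin_num by exact: fin_num_measure.
  rewrite -(fineK PNfin) lee_fin -(cvg_lim _ cv)//.
  apply: limr_ge; first by apply/cvg_ex; eexists; exact: cv.
  by near=> m; rewrite -lee_fin fineK.
have /(negligibleS _) : P.-negligible (\bigcup_j N j).
  apply: negligible_bigcup => j.
  by apply/negligibleP; [exact: mN|exact: N0].
apply => w /= ncvg; apply: contrapT => H; apply: ncvg.
apply/cauchy_cvgP/cauchy_exP => e e0.
have [j _ /(_ j (leqnn j)) je] := near_infty_natSinv_lt (PosNum e0).
have : ~ N j w by move=> Njw; apply: H; exists j.
move=> /existsNP[m /not_implyP[_ nbad]].
exists (series (fun n => D n w) m); exists m => // n /= mn.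
rewrite /= /ball/= distrC.
apply: le_lt_trans je; rewrite leNgt; apply/negP => /ltW lt.
apply: nbad; apply: (@overshoot_sum _ _ _ _ _ (n - m)).
apply: le_trans lt _; rewrite le_eqVlt; apply/orP; left; apply/eqP; congr `|_|.
rewrite sub_series_geq// -{1}[m]add0n big_addn big_mkord.
by under eq_bigr do rewrite addnC.
Unshelve. all: by end_near. Qed.

End martingale_convergence.

(** * Noise along a trajectory of the decision process *)

Lemma finite_range_bounded (R : realType) (I : finType) (f : I -> R) :
  exists2 B, 0 <= B & forall i, `|f i| <= B.
Proof.
exists (\sum_i `|f i|); first by apply: sumr_ge0.
by move=> i; rewrite (bigD1 i)//= lerDl sumr_ge0.
Qed.

Lemma ae_forall_fin d (T : measurableType d) (R : realType) (P : probability T R)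
    (I : finType) (Q : I -> T -> Prop) :
  (forall i, {ae P, forall w, Q i w}) -> {ae P, forall w, forall i, Q i w}.
Proof.
move=> h.
have := @ae_foralln _ _ _ P (fun n w => if unpickle n is Some i then Q i w else True).
have h' n : {ae P, forall w, if @unpickle I n is Some i then Q i w else True}.
  by case: (unpickle n) => [i|]; [exact: h|exact: aeW].
move=> /(_ h'); apply: filterS => w H i.
by have := H (pickle i); rewrite pickleK.
Qed.

Section finite_valued.
Context d (T : measurableType d) (R : realType) (I : finType) (Y : T -> I).
Hypothesis mY : forall i, measurable (Y @^-1` [set i]).

Lemma measurable_fun_finite_valued (f : I -> R) :
  measurable_fun [set: T] (fun w => f (Y w)).
Proof.
move=> _ B mB; rewrite setTI.
rewrite (_ : _ @^-1` B = \bigcup_(i in [set i | B (f i)]) (Y @^-1` [set i])).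
  by apply: fin_bigcup_measurable => //; exact: finite_finset.
apply/seteqP; split => w /=; first by move=> Bw; exists (Y w).
by move=> [i /= Bi ->].
Qed.

Lemma integral_finite_valued (mu : {measure set T -> \bar R}) (f : T -> R) :
  measurable_fun [set: T] f ->
  (\int[mu]_w (f w)%:E = \sum_i \int[mu]_(w in Y @^-1` [set i]) (f w)%:E)%E.
Proof.
move=> mf.
have E : \big[setU/set0]_(i <- index_enum I) (Y @^-1` [set i]) = [set: T].
  apply/seteqP; split => // w _; rewrite -bigcup_seq_cond.
  by exists (Y w) => //=; rewrite mem_index_enum.
rewrite -E integral_bigsetU_EFin//.
- exact: index_enum_uniq.
- apply/trivIsetP => i j _ _ ij; apply/seteqP; split => w //= [Yi Yj].
  by move: ij; rewrite -Yi -Yj eqxx.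
- by rewrite E; exact/measurable_EFinP.
Qed.

End finite_valued.

(** The sets whose generated sigma-algebra is, by conversion, the history up to
time [n]; isolating them allows one to say that a function depends on the past
only, as measurability on [g_sigma_algebraType]. *)
Definition history_generators d (T : measurableType d) (R : realType)
    (S U : finType) (dim : nat) (theta0 w0 : T -> 'cV[R]_dim)
    (X : nat -> T -> S) (Ac : nat -> T -> U) (Rw : nat -> T -> R) (n : nat) :
    set (set T) :=
  [set E | [\/ exists i, exists2 B : set R, measurable B &
                 E = (fun w => theta0 w i 0) @^-1` B
                 \/ E = (fun w => w0 w i 0) @^-1` B,
               exists2 k, (k <= n)%N & exists s, E = X k @^-1` [set s],
               exists2 k, (k < n)%N & exists a, E = Ac k @^-1` [set a] |
               exists2 k, (k < n)%N & exists2 B : set R, measurable B &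
                 E = Rw k @^-1` B ] ].

Section trajectory.
Context d (T : measurableType d) (R : realType) (P : probability T R).
Context (S U : finType) (dim : nat).
Variables (p : S -> U -> S -> R) (r : S -> U -> S -> R)
  (q : S -> U -> S -> probability R R) (pib : S -> U -> R)
  (theta0 w0 : T -> 'cV[R]_dim)
  (X : nat -> T -> S) (Ac : nat -> T -> U) (Rw : nat -> T -> R).
Hypotheses (p_distr : forall s a, is_distr (p s a))
  (q_int : forall s a s', (q s a s').-integrable setT (fun x : R => x%:E))
  (q_mean : forall s a s', (\int[q s a s']_x x%:E = (r s a s')%:E)%E)
  (pib_distr : forall s, is_distr (pib s))
  (X_meas : forall n s, measurable (X n @^-1` [set s]))
  (Ac_meas : forall n u, measurable (Ac n @^-1` [set u]))
  (Rw_meas : forall n, measurable_fun setT (Rw n))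
  (theta0_meas : forall i, measurable_fun setT (fun w => theta0 w i 0))
  (w0_meas : forall i, measurable_fun setT (fun w => w0 w i 0))
  (traj : generated_by P pib p q theta0 w0 X Ac Rw).

Let G := history_generators theta0 w0 X Ac Rw.

Lemma history_measurable n : <<s G n>> `<=` measurable.
Proof.
apply: smallest_sub; first exact: sigma_algebra_measurable.
move=> E [[i [B mB [->|->]]]|[k kn [s ->]]|[k kn [s ->]]|[k kn [B mB ->]]] //.
- by rewrite -[X in measurable X]setTI; exact: theta0_meas.
- by rewrite -[X in measurable X]setTI; exact: w0_meas.
- by rewrite -[X in measurable X]setTI; exact: Rw_meas.
Qed.

Lemma history_increasing n : <<s G n>> `<=` <<s G n.+1>>.
Proof.
apply: sub_sigma_algebra2 => E [h|[k kn h]|[k kn h]|[k kn h]].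
- by apply: Or41.
- by apply: Or42; exists k => //; exact: leqW.
- by apply: Or43; exists k => //; exact: leqW.
- by apply: Or44; exists k => //; exact: leqW.
Qed.

Lemma adapted_theta0 i :
  measurable_fun [set: g_sigma_algebraType (G 0)] (fun w => theta0 w i 0).
Proof.
by move=> _ B mB; rewrite setTI; apply: sub_sigma_algebra; apply: Or41; exists i, B => //; left.
Qed.

Lemma adapted_w0 i :
  measurable_fun [set: g_sigma_algebraType (G 0)] (fun w => w0 w i 0).
Proof.
by move=> _ B mB; rewrite setTI; apply: sub_sigma_algebra; apply: Or41; exists i, B => //; right.
Qed.

Lemma adapted_state n (f : S -> R) :
  measurable_fun [set: g_sigma_algebraType (G n)] (fun w => f (X n w)).
Proof.
apply: measurable_fun_finite_valued => s.
by apply: sub_sigma_algebra; apply: Or42; exists n => //; exists s.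
Qed.

Lemma adapted_reward n :
  measurable_fun [set: g_sigma_algebraType (G n.+1)] (Rw n).
Proof.
by move=> _ B mB; rewrite setTI; apply: sub_sigma_algebra; apply: Or44; exists n => //; exists B.
Qed.

Let step n w : S * U * S := (X n w, Ac n w, X n.+1 w).

Let stepE n i : step n @^-1` [set i] =
  [set w | [/\ X n w = i.1.1, Ac n w = i.1.2 & X n.+1 w = i.2]].
Proof.
apply/seteqP; rewrite /step; case: i => [[s u] s']; split => w /=.
  by move=> [-> -> ->].
by move=> [-> -> ->].
Qed.

Let step_history n i : <<s G n.+1>> (step n @^-1` [set i]).
Proof.
rewrite stepE.
rewrite (_ : [set w | _] = X n @^-1` [set i.1.1] `&` Ac n @^-1` [set i.1.2]
   `&` X n.+1 @^-1` [set i.2]); last first.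
  by apply/seteqP; split => w /=; [move=> [-> -> ->]|move=> [[-> ->] ->]].
apply: (@measurableI _ (g_sigma_algebraType (G n.+1))).
  apply: (@measurableI _ (g_sigma_algebraType (G n.+1))).
  - by apply: sub_sigma_algebra; apply: Or42; exists n => //; eexists.
  - by apply: sub_sigma_algebra; apply: Or43; exists n => //; eexists.
- by apply: sub_sigma_algebra; apply: Or42; exists n.+1 => //; eexists.
Qed.

Let step_measurable n i : measurable (step n @^-1` [set i]).
Proof. exact: (history_measurable (@step_history n i)). Qed.

Lemma adapted_step n (f : S -> U -> S -> R) :
  measurable_fun [set: g_sigma_algebraType (G n.+1)]
    (fun w => f (X n w) (Ac n w) (X n.+1 w)).
Proof.
exact: (@measurable_fun_finite_valued _ (g_sigma_algebraType (G n.+1)) _ _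
  (step n) (@step_history n) (fun i => f i.1.1 i.1.2 i.2)).
Qed.

Let pib0 s u : 0 <= pib s u. Proof. by have [] := pib_distr s. Qed.

Let p0 s u s' : 0 <= p s u s'. Proof. by have [] := p_distr s u. Qed.

Let tp0 s u s' : 0 <= pib s u * p s u s'. Proof. exact: mulr_ge0. Qed.

Let law n (i : S * U * S) E B : <<s G n>> E -> measurable B ->
  (P (E `&` (step n @^-1` [set i] `&` Rw n @^-1` B)) =
   P (E `&` X n @^-1` [set i.1.1]) * ((NngNum (tp0 i.1.1 i.1.2 i.2))%:num)%:E * q i.1.1 i.1.2 i.2 B)%E.
Proof.
move=> hE mB; rewrite stepE /= -(@traj n E _ _ _ B hE mB).
congr (P _); apply/seteqP; split => w /=.
  by move=> [Ew [[? ? ?] ?]]; split.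
by move=> [Ew [? ? ? ?]]; split.
Qed.

Let K := state_kernel pib p.

(** The updates are affine in the reward, with coefficients that depend on the
transition; the observables are therefore taken of the form
[al(X_n, A_n, X_(n+1)) R_n + be(X_n, A_n, X_(n+1))], and this is their mean given
[X_n = s]. *)
Definition step_mean (al be : S -> U -> S -> R) (s : S) : R :=
  \sum_u \sum_s' pib s u * p s u s' * (al s u s' * r s u s' + be s u s').

Lemma step_probs s : \sum_u \sum_s' pib s u * p s u s' = 1.
Proof.
have [_ <-] := pib_distr s; apply: eq_bigr => u _.
by rewrite -mulr_sumr; have [_ ->] := p_distr s u; rewrite mulr1.
Qed.

Lemma affine_reward_mean (x y : R) s u s' :
  (q s u s').-integrable setT (EFin \o (fun z => x * z + y)) /\
  (\int[q s u s']_z (x * z + y)%:E = (x * r s u s' + y)%:E)%E.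
Proof.
have i1 : (q s u s').-integrable setT (EFin \o (fun z => x * z)).
  exact: (integrableZl measurableT x (q_int s u s')).
have i2 : (q s u s').-integrable setT (EFin \o (fun=> y)).
  by apply: finite_measure_integrable_cst.
split; first exact: (integrableD measurableT i1 i2).
rewrite [LHS](integralD_EFin measurableT i1 i2).
rewrite [X in (_ + X)%E](integral_cst _ measurableT y%:E).
rewrite [X in (_ + _ * X)%E](@probability_setT _ _ _ (q s u s')) mule1 EFinD; congr (_ + _)%E.
by rewrite EFinM -q_mean -(integralZl measurableT (q_int s u s')).
Qed.

(** The integral is split according to the transition [(s, u, s')] made at time
[n].  On each piece the reward integrates to its mean by [integral_cond_law], which
leaves the integral of [k] over [X_n = s] times a constant, and these constants
sum to zero over [u] and [s']. *)
Lemma step_centered n (k : T -> R) (M : R) (al be : S -> U -> S -> R) :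
  measurable_fun [set: g_sigma_algebraType (G n)] k -> (forall w, `|k w| <= M) ->
  (\int[P]_w (k w * (al (X n w) (Ac n w) (X n.+1 w) * Rw n w
      + be (X n w) (Ac n w) (X n.+1 w) - step_mean al be (X n w)))%:E = 0)%E.
Proof.
move=> mk kM.
have mkT : measurable_fun [set: T] k := measurable_fun_ambient (@history_measurable n) mk.
rewrite (integral_finite_valued (@step_measurable n)); last first.
  apply: measurable_funM => //; apply: measurable_funB; last first.
    exact: (measurable_fun_ambient (@history_measurable n) (@adapted_state n _)).
  apply: measurable_funD; last first.
    exact: (measurable_fun_ambient (@history_measurable n.+1) (@adapted_step n _)).
  apply: measurable_funM => //.
  exact: (measurable_fun_ambient (@history_measurable n.+1) (@adapted_step n _)).
pose kap s := fine (\int[P]_(w in X n @^-1` [set s]) (k w)%:E).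
have kapE s : (\int[P]_(w in X n @^-1` [set s]) (k w)%:E = (kap s)%:E)%E.
  rewrite /kap fineK//; apply: integrable_fin_num => //.
  apply: measurable_bounded_integrable => //.
  - by rewrite (le_lt_trans (probability_le1 P _))// ltry.
  - exact: measurable_funTS.
  - exists M; split; first exact: num_real.
    by move=> x Mx y _ /=; apply: le_trans (kM _) (ltW Mx).
transitivity (\sum_(i : S * U * S) ((pib i.1.1 i.1.2 * p i.1.1 i.1.2 i.2 * kap i.1.1 *
  (al i.1.1 i.1.2 i.2 * r i.1.1 i.1.2 i.2 + be i.1.1 i.1.2 i.2 - step_mean al be i.1.1)))%:E)%E.
  apply: eq_bigr => i _.
  pose g z := al i.1.1 i.1.2 i.2 * z + (be i.1.1 i.1.2 i.2 - step_mean al be i.1.1).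
  have [gi gE] := affine_reward_mean (al i.1.1 i.1.2 i.2)
    (be i.1.1 i.1.2 i.2 - step_mean al be i.1.1) i.1.1 i.1.2 i.2.
  have [_] := integral_cond_law (@history_measurable n) (step_measurable n i) (X_meas n i.1.1)
    (Rw_meas n) (@law n i) mk kM gi.
  rewrite /= kapE gE -!EFinM addrA => <-.
  apply: eq_integral => w /[!inE]; rewrite stepE => -[-> -> ->].
  by rewrite addrA.
rewrite sumEFin; congr EFin.
rewrite -(pair_bigA _ (fun (x : S * U) s' => pib x.1 x.2 * p x.1 x.2 s' * kap x.1 *
  (al x.1 x.2 s' * r x.1 x.2 s' + be x.1 x.2 s' - step_mean al be x.1)))/=.
rewrite -(pair_bigA _ (fun s u => \sum_s' pib s u * p s u s' * kap s *
  (al s u s' * r s u s' + be s u s' - step_mean al be s)))/=.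
apply: big1 => s _.
transitivity (kap s * (\sum_u \sum_s' pib s u * p s u s' * (al s u s' * r s u s' + be s u s') -
  \sum_u \sum_s' pib s u * p s u s' * step_mean al be s)).
  rewrite -sumrB mulr_sumr; apply: eq_bigr => u _.
  by rewrite -sumrB mulr_sumr; apply: eq_bigr => s' _; ring.
have -> : \sum_u \sum_s' pib s u * p s u s' * step_mean al be s = step_mean al be s.
  under eq_bigr do rewrite -mulr_suml.
  by rewrite -mulr_suml step_probs mul1r.
by rewrite subrr mulr0.
Qed.

(** The conditional second moment of the reward given a transition does not
depend on the time: it is that of [q s u s'].  It is finite for each transition
of positive probability at some time, and there are finitely many
transitions. *)
Lemma reward_second_moment_bounded :
  (forall n s s', let E := [set w | X n w = s /\ X n.+1 w = s'] in
    (0 < P E)%E -> (cond_mean P (fun w => Rw n w ^+ 2)%R E < +oo)%E) ->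
  exists M2 : R, forall n, (\int[P]_w (Rw n w ^+ 2)%:E <= M2%:E)%E.
Proof.
move=> Rw_sq.
pose m2 (i : S * U * S) := (\int[q i.1.1 i.1.2 i.2]_x (x ^+ 2)%:E)%E.
exists (\sum_i fine (m2 i)) => n.
have mR2 : measurable_fun [set: T] (fun w => Rw n w ^+ 2) by exact: measurable_funX.
rewrite (integral_finite_valued (@step_measurable n))// -sumEFin.
apply: lee_sum => i _.
have cellE := ge0_integral_cond_law (@history_measurable n) (step_measurable n i)
  (X_meas n i.1.1) (Rw_meas n) (@law n i) (h := fun=> 1) (g := fun x => x ^+ 2)
  (@measurable_cst _ _ _ _ _ _) (exprn_measurable _) (fun=> ler01) (fun x => sqr_ge0 x).
have PE := @law n i setT setT (@measurableT _ (g_sigma_algebraType (G n))) measurableT.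
rewrite preimage_setT setIT !setTI probability_setT mule1 in PE.
have cellE' : (\int[P]_(w in step n @^-1` [set i]) (Rw n w ^+ 2)%:E =
    P (step n @^-1` [set i]) * m2 i)%E.
  under eq_integral do rewrite -[Rw n _ ^+ 2]mul1r.
  rewrite cellE PE; congr (_ * _)%E.
  by rewrite (@integral_cst _ _ _ P _ (X_meas n i.1.1) 1%:E) mul1e muleC.
have m20 : (0 <= m2 i)%E by apply: integral_ge0 => x _; rewrite lee_fin sqr_ge0.
have [Pi0|Pi0] := eqVneq (P (step n @^-1` [set i])) 0%E.
  by rewrite cellE' Pi0 mul0e lee_fin fine_ge0.
have {Pi0} Pi0 : (0 < P (step n @^-1` [set i]))%E by rewrite lt0e Pi0 measure_ge0.
pose E := [set w | X n w = i.1.1 /\ X n.+1 w = i.2].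
have mE : measurable E.
  by rewrite (_ : E = X n @^-1` [set i.1.1] `&` X n.+1 @^-1` [set i.2])//; exact: measurableI.
have iE : step n @^-1` [set i] `<=` E by rewrite stepE => w [].
have PE0 : (0 < P E)%E.
  by apply: lt_le_trans Pi0 _; apply: le_measure; rewrite ?inE.
have intE : (\int[P]_(w in E) (Rw n w ^+ 2)%:E < +oo)%E.
  have := Rw_sq n _ _ PE0; rewrite /cond_mean -/E.
  have : (0 < (fine (P E))^-1).
    by rewrite invr_gt0 fine_gt0// PE0/= -ge0_fin_numE// fin_num_measure.
  case: (\int[P]_(w in E) _)%E => [x||] h //; first by move=> _; exact: ltry.
  by rewrite gt0_muley// lte_fin.
have cell_lty : (P (step n @^-1` [set i]) * m2 i < +oo)%E.
  rewrite -cellE'; apply: le_lt_trans intE.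
  apply: ge0_subset_integral => //.
  - by apply/measurable_EFinP; exact: measurable_funTS.
  - by move=> w _; rewrite lee_fin sqr_ge0.
have m2_fin : m2 i \is a fin_num.
  move: cell_lty m20; case: (m2 i) => //.
  by rewrite gt0_muley.
rewrite cellE' fineK//.
by rewrite -[leRHS]mul1e lee_wpmul2r// probability_le1.
Qed.

Variable M2 : R.
Hypothesis Rw_M2 : forall n, (\int[P]_w (Rw n w ^+ 2)%:E <= M2%:E)%E.

Let noise (al be : S -> U -> S -> R) n w :=
  al (X n w) (Ac n w) (X n.+1 w) * Rw n w
    + be (X n w) (Ac n w) (X n.+1 w) - step_mean al be (X n w).

Let adapted_noise al be n :
  measurable_fun [set: g_sigma_algebraType (G n.+1)] (noise al be n).
Proof.
apply: measurable_funB; last first.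
  exact: (measurable_fun_coarser (@history_increasing n) (@adapted_state n _)).
apply: measurable_funD; last exact: adapted_step.
by apply: measurable_funM; [exact: adapted_step|exact: adapted_reward].
Qed.

Let noise_le al be : exists2 B, 0 <= B &
  forall n w, noise al be n w ^+ 2 <= B * (1 + Rw n w ^+ 2).
Proof.
have [A A0 Al] := finite_range_bounded (fun i : S * U * S => al i.1.1 i.1.2 i.2).
have [B B0 Bl] := finite_range_bounded (fun i : S * U * S =>
  be i.1.1 i.1.2 i.2 - step_mean al be i.1.1).
exists (2 * (A ^+ 2 + B ^+ 2)); first by rewrite mulr_ge0// addr_ge0// sqr_ge0.
move=> n w; rewrite /noise -addrA.
have := Al (X n w, Ac n w, X n.+1 w); have := Bl (X n w, Ac n w, X n.+1 w) => /=.
move: (al _ _ _) (be _ _ _ - _) (Rw n w) => x y z yB xA.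
have x2 : x ^+ 2 <= A ^+ 2 by rewrite -(real_normK (num_real x)) ler_pXn2r// nnegrE.
have y2 : y ^+ 2 <= B ^+ 2 by rewrite -(real_normK (num_real y)) ler_pXn2r// nnegrE.
have := sqr_ge0 (x * z - y); have := sqr_ge0 z.
have : x ^+ 2 * z ^+ 2 <= A ^+ 2 * z ^+ 2 by rewrite ler_wpM2r// sqr_ge0.
have : 0 <= B ^+ 2 * z ^+ 2 by rewrite mulr_ge0// sqr_ge0.
have := sqr_ge0 A.
nra.
Qed.

Let expectation_reward_sq n (B : R) : 0 <= B ->
  (\int[P]_w (B * (1 + Rw n w ^+ 2))%:E <= (B * (1 + M2))%:E)%E.
Proof.
move=> B0; under eq_integral do rewrite EFinM EFinD.
have mR2 : measurable_fun [set: T] (fun w => (Rw n w ^+ 2)%:E).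
  by apply/measurable_EFinP; exact: measurable_funX.
rewrite ge0_integralZl//.
- rewrite EFinM lee_wpmul2l ?lee_fin// EFinD ge0_integralD//.
  + rewrite [X in (X + _)%E](integral_cst P measurableT 1%:E).
    by rewrite [X in (_ * X + _)%E](@probability_setT _ _ _ P) mule1 leeD2l.
  + by move=> w _; rewrite lee_fin sqr_ge0.
- exact: emeasurable_funD.
- by move=> w _; rewrite -EFinD lee_fin addr_ge0// sqr_ge0.
Qed.

Let bounded_noise_cvg (al be : S -> U -> S -> R) (zeta : nat -> T -> R) (N : R) (c : nat -> R) :
  (forall n, measurable_fun [set: g_sigma_algebraType (G n)] (zeta n)) ->
  (forall n w, `|zeta n w| <= N) ->
  cvgn (series (fun n => c n ^+ 2)) ->
  {ae P, forall w, cvgn (series (fun n => c n * zeta n w * noise al be n w))}.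
Proof.
move=> mz zN cc.
have [B B0 Bl] := noise_le al be.
apply: (@martingale_series_cvg _ _ _ P G (fun n w => c n * zeta n w * noise al be n w)
  (fun n => c n ^+ 2 * (N ^+ 2 * (B * (1 + M2))))).
- exact: history_measurable.
- exact: history_increasing.
- move=> n; apply: measurable_funM; last exact: adapted_noise.
  apply: measurable_funM => //.
  exact: (measurable_fun_coarser (@history_increasing n) (mz n)).
- move=> n; rewrite (mulrA (N ^+ 2)) (mulrA (c n ^+ 2)).
  have k0 : 0 <= c n ^+ 2 * (N ^+ 2 * B).
    by apply: mulr_ge0; [exact: sqr_ge0|apply: mulr_ge0 => //; exact: sqr_ge0].
  apply: le_trans (expectation_reward_sq n k0).
  apply: ge0_le_integral => //.
  + by move=> w _; rewrite lee_fin sqr_ge0.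
  + apply/measurable_EFinP/measurable_funX/(measurable_fun_ambient (@history_measurable n.+1)).
    apply: measurable_funM; last exact: adapted_noise.
    apply: measurable_funM => //.
    exact: (measurable_fun_coarser (@history_increasing n) (mz n)).
  + apply/measurable_EFinP; apply: measurable_funM => //.
    by apply: measurable_funD => //; exact: measurable_funX.
  + move=> w _; rewrite lee_fin !exprMn -[leLHS]mulrA -[leRHS]mulrA ler_wpM2l ?sqr_ge0//.
    rewrite -[leRHS]mulrA.
    apply: ler_pM; rewrite ?sqr_ge0//.
    rewrite -(real_normK (num_real (zeta n w))) ler_pXn2r// nnegrE//.
    exact: le_trans (zN n w).
- move=> n h M mh hM.
  under eq_integral do rewrite mulrA.
  apply: (@step_centered n (fun w => h w * (c n * zeta n w)) (M * (`|c n| * N))).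
    by apply: measurable_funM => //; apply: measurable_funM.
  by move=> w; rewrite !normrM ler_pM// ler_pM.
- under eq_fun do rewrite mulrC.
  exact: is_cvg_seriesZ.
Qed.

(** The multipliers [zeta] are only bounded by a random constant, so that their
products with the noise may fail to be square integrable.  Setting [zeta n] to 0
when it exceeds [N] keeps it a function of the past; for each integer [N] the
truncated series converges almost surely, and on almost every trajectory it is
the original series as soon as [N] is large. *)
Lemma martingale_noise_cvg (al be : S -> U -> S -> R) (zeta : nat -> T -> R) (c : nat -> R) :
  (forall n, measurable_fun [set: g_sigma_algebraType (G n)] (zeta n)) ->
  {ae P, forall w, exists N : R, forall n, `|zeta n w| <= N} ->
  cvgn (series (fun n => c n ^+ 2)) ->
  {ae P, forall w, cvgn (series (fun n => c n * zeta n w * noise al be n w))}.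
Proof.
move=> mz zN cc.
pose trunc (N : nat) n w := if `|zeta n w| <= N%:R then zeta n w else 0.
have tc (N : nat) : {ae P, forall w, cvgn (series (fun n => c n * trunc N n w * noise al be n w))}.
  apply: (@bounded_noise_cvg _ _ _ N%:R) => //.
  - move=> n; apply: measurable_fun_ifT => //.
    by apply: measurable_fun_ler => //; exact: measurableT_comp.
  - by move=> n w; rewrite /trunc; case: ifPn => // _; rewrite normr0.
have := ae_foralln tc; apply: filterS2 zN => w [N zN] /(_ (Num.bound N)).
have E n : trunc (Num.bound N) n w = zeta n w.
  rewrite /trunc ifT//; apply: le_trans (zN n) (ltW (archi_boundP _)).
  exact: le_trans (normr_ge0 _) (zN n).
rewrite (_ : (fun n => _) = fun n => c n * zeta n w * noise al be n w)//.
by apply/funext => n; rewrite E.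
Qed.

(** The sum has a finite expectation, as [1 + |R_n| <= 2 (1 + R_n^2)] and the
second moments of the rewards are bounded. *)
Lemma reward_series_cvg (e : nat -> R) : (forall n, 0 <= e n) -> cvgn (series e) ->
  {ae P, forall w, cvgn (series (fun n => e n * (1 + `|Rw n w|)))}.
Proof.
move=> e0 ce.
pose f (n : nat) (w : T) := (e n * (1 + Rw n w ^+ 2))%:E.
have f0 n w : (0 <= f n w)%E by rewrite lee_fin mulr_ge0// addr_ge0// sqr_ge0.
have mf n : measurable_fun [set: T] (f n).
  apply/measurable_EFinP; apply: measurable_funM => //.
  by apply: measurable_funD => //; exact: measurable_funX.
have M20 : 0 <= M2.
  rewrite -lee_fin; apply: le_trans (Rw_M2 0); apply: integral_ge0 => w _.
  by rewrite lee_fin sqr_ge0.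
have Fi : P.-integrable setT (fun w => (\sum_(0 <= n <oo) f n w)%E).
  apply/integrableP; split; first exact: ge0_emeasurable_sum.
  under eq_integral do rewrite gee0_abs ?nneseries_ge0//.
  rewrite integral_nneseries//.
  apply: (@le_lt_trans _ _ (\sum_(0 <= n <oo) (e n * (1 + M2))%:E)%E).
    apply: lee_nneseries => n _; last exact: expectation_reward_sq.
    by move=> _; apply: integral_ge0.
  have cv : cvgn (series (fun n => e n * (1 + M2))).
    by under eq_fun do rewrite mulrC; exact: is_cvg_seriesZ.
  rewrite (_ : (\sum_(0 <= n <oo) _)%E = (limn (series (fun n => e n * (1 + M2))))%:E) ?ltry//.
  rewrite -EFin_lim//; set u := (fun n => _); set u' := EFin \o _.
  by rewrite (_ : u = u')//; apply/funext => n; rewrite /u sumEFin.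
have := integrable_ae measurableT Fi; apply: filterS => w /(_ I) fin.
apply: nondecreasing_is_cvgn.
  by apply: nondecreasing_series => n _ _; rewrite mulr_ge0// addr_ge0.
exists (2 * fine (\sum_(0 <= n <oo) f n w)%E) => _ [n _ <-].
apply: (@le_trans _ _ (2 * \sum_(0 <= k < n) e k * (1 + Rw k w ^+ 2))).
  rewrite mulr_sumr; apply: ler_sum => k _.
  rewrite mulrCA ler_wpM2l//.
  have := sqr_ge0 (`|Rw k w| - 1); rewrite -[Rw k w ^+ 2]real_normK ?num_real//.
  by have := normr_ge0 (Rw k w); nra.
rewrite ler_pM2l// -lee_fin fineK// -sumEFin.
by apply: (@nneseries_lim_ge _ (f ^~ w) xpredT 0) => k _ _; exact: f0.
Qed.

Variable nu : S -> R.
Hypotheses (X_irr : irreducible_kernel K) (nu_stat : stationary K nu).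

Definition stationary_mean (al be : S -> U -> S -> R) : R :=
  \sum_s nu s * step_mean al be s.

(** With [V] solving the Poisson equation for the means given the state,
[al R_n + be - mean] is the martingale difference of the observable
[al R_n + be + V(X_(n+1))] plus [V(X_n) - V(X_(n+1))]. *)
Lemma state_noise_cvg (al be : S -> U -> S -> R) (zeta : nat -> T -> R) (c : nat -> R) :
  (forall n, 0 <= c n) -> (forall n, c n.+1 <= c n) -> c n @[n --> \oo] --> 0 ->
  cvgn (series (fun n => c n ^+ 2)) ->
  (forall n, measurable_fun [set: g_sigma_algebraType (G n)] (zeta n)) ->
  {ae P, forall w, exists N : R, forall n, `|zeta n w| <= N} ->
  {ae P, forall w, cvgn (series (fun n => c n * `|zeta n.+1 w - zeta n w|))} ->
  {ae P, forall w, cvgn (series (fun n => c n * zeta n w *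
    (al (X n w) (Ac n w) (X n.+1 w) * Rw n w
      + be (X n w) (Ac n w) (X n.+1 w) - stationary_mean al be)))}.
Proof.
move=> c0 cn cc c2 mz zN zc.
have K0 s s' : 0 <= K s s' by apply: sumr_ge0 => u _; exact: tp0.
have K1 s : \sum_s' K s s' = 1 by rewrite exchange_big/= step_probs.
have [V VP] := poisson_solution K0 K1 X_irr nu_stat (step_mean al be).
pose be' s u s' := be s u s' + V s'.
have meanE s : step_mean al be' s = step_mean al be s + \sum_s' K s s' * V s'.
  rewrite /step_mean /K /state_kernel.
  under [X in _ = _ + X]eq_bigr do rewrite mulr_suml.
  rewrite [X in _ = _ + X]exchange_big/= -big_split/=.
  apply: eq_bigr => u _; rewrite -big_split/=; apply: eq_bigr => s' _.
  by rewrite /be'; ring.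
have [W W0 VW] := finite_range_bounded V.
have := @martingale_noise_cvg al be' zeta c mz zN c2.
apply: filterS3 zN zc => w [N zN] zc mc.
rewrite (_ : (fun n => _) = (fun n => c n * zeta n w * noise al be' n w) +
    (fun n => c n * zeta n w * (V (X n w) - V (X n.+1 w)))).
  apply: is_cvg_seriesD => //.
  exact: (@summation_by_parts_cvg _ c (zeta ^~ w) (fun n => V (X n w)) N W).
apply/funext => n; rewrite -mulrDr; congr (_ * _).
transitivity (noise al be' n w + (V (X n w) - V (X n.+1 w))) => //.
by rewrite /noise meanE /stationary_mean /be'; have := VP (X n w); lra.
Qed.

(** The two updates have the same shape: the next iterate is the current one plus
the step size times an observable minus linear combinations of the coordinates of
[theta] and [wt] with observables as coefficients.  They share [al] and [A] and
differ by [N1] and [N2]. *)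
Variables (theta wt : nat -> T -> 'cV[R]_dim) (a b : nat -> R).
Variables (al : 'I_dim -> S -> U -> S -> R) (A N1 N2 : 'I_dim -> 'I_dim -> S -> U -> S -> R).
Hypotheses (theta_init : theta 0 = theta0) (wt_init : wt 0 = w0).
Hypotheses (a0 : forall n, 0 < a n) (b0 : forall n, 0 < b n)
  (a_ninc : forall n, a n.+1 <= a n) (b_ninc : forall n, b n.+1 <= b n)
  (ab_sq : cvgn (series (fun n => a n ^+ 2 + b n ^+ 2))).

Let obs (f : S -> U -> S -> R) n w := f (X n w) (Ac n w) (X n.+1 w).

Let drive (N : 'I_dim -> 'I_dim -> S -> U -> S -> R) i n w :=
  obs (al i) n w * Rw n w - (\sum_k obs (A i k) n w * theta n w k 0)
    - \sum_k obs (N i k) n w * wt n w k 0.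

Hypotheses
  (theta_rec : forall n w i, theta n.+1 w i 0 = theta n w i 0 + a n * drive N1 i n w)
  (wt_rec : forall n w i, wt n.+1 w i 0 = wt n w i 0 + b n * drive N2 i n w)
  (stable : {ae P, forall w, exists B : R, forall n i,
    `|theta n w i 0| <= B /\ `|wt n w i 0| <= B}).

Lemma adapted_iterates n i :
  measurable_fun [set: g_sigma_algebraType (G n)] (fun w => theta n w i 0) /\
  measurable_fun [set: g_sigma_algebraType (G n)] (fun w => wt n w i 0).
Proof.
elim: n i => [|n IH] i.
  by rewrite theta_init wt_init; split; [exact: adapted_theta0|exact: adapted_w0].
have mth k : measurable_fun [set: g_sigma_algebraType (G n.+1)] (fun w => theta n w k 0).
  exact: (measurable_fun_coarser (@history_increasing n) (IH k).1).
have mwt k : measurable_fun [set: g_sigma_algebraType (G n.+1)] (fun w => wt n w k 0).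
  exact: (measurable_fun_coarser (@history_increasing n) (IH k).2).
have mdrive N : measurable_fun [set: g_sigma_algebraType (G n.+1)] (drive N i n).
  apply: measurable_funB; first apply: measurable_funB.
  - by apply: measurable_funM; [exact: adapted_step|exact: adapted_reward].
  - apply: measurable_sum => k; apply: measurable_funM; [exact: adapted_step|exact: mth].
  - apply: measurable_sum => k; apply: measurable_funM; [exact: adapted_step|exact: mwt].
split.
- rewrite (_ : (fun w => _) = fun w => theta n w i 0 + a n * drive N1 i n w).
    by apply: measurable_funD => //; apply: measurable_funM.
  by apply/funext => w.
- rewrite (_ : (fun w => _) = fun w => wt n w i 0 + b n * drive N2 i n w).
    by apply: measurable_funD => //; apply: measurable_funM.
  by apply/funext => w.
Qed.

(** A common summable bound for all products of two step sizes. *)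
Let e n := a n ^+ 2 + b n ^+ 2.

Let drive_le N : exists2 D, 0 <= D & forall w B, (forall n i,
    `|theta n w i 0| <= B /\ `|wt n w i 0| <= B) -> forall i n,
    `|drive N i n w| <= (D * (1 + dim%:R * B)) * (1 + `|Rw n w|).
Proof.
have [D1 D10 D1P] := finite_range_bounded
  (fun y : 'I_dim * (S * U * S) => al y.1 y.2.1.1 y.2.1.2 y.2.2).
have [D2 D20 D2P] := finite_range_bounded
  (fun y : 'I_dim * 'I_dim * (S * U * S) => A y.1.1 y.1.2 y.2.1.1 y.2.1.2 y.2.2).
have [D3 D30 D3P] := finite_range_bounded
  (fun y : 'I_dim * 'I_dim * (S * U * S) => N y.1.1 y.1.2 y.2.1.1 y.2.1.2 y.2.2).
exists (D1 + D2 + D3); first by rewrite !addr_ge0.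
move=> w B wB i n.
have B0 : 0 <= B by apply: le_trans (normr_ge0 _) (wB n i).1.
have sum_le (D : R) (f g : 'I_dim -> R) : (forall k, `|f k| <= D) -> (forall k, `|g k| <= B) ->
    `|\sum_k f k * g k| <= D * (dim%:R * B).
  move=> fD gB; apply: le_trans (ler_norm_sum _ _ _) _.
  apply: (@le_trans _ _ (\sum_(k < dim) D * B)).
    by apply: ler_sum => k _; rewrite normrM ler_pM.
  by rewrite sumr_const card_ord -[leLHS]mulr_natl mulrCA.
have h1 := D1P (i, (X n w, Ac n w, X n.+1 w)).
have h2 := sum_le D2 (fun k => obs (A i k) n w) (fun k => theta n w k 0)
  (fun k => D2P (i, k, (X n w, Ac n w, X n.+1 w))) (fun k => (wB n k).1).
have h3 := sum_le D3 (fun k => obs (N i k) n w) (fun k => wt n w k 0)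
  (fun k => D3P (i, k, (X n w, Ac n w, X n.+1 w))) (fun k => (wB n k).2).
rewrite /drive; apply: le_trans (ler_normB _ _) _.
apply: le_trans (lerD (ler_normB _ _) (lexx _)) _.
apply: le_trans (lerD (lerD (lexx _) h2) h3) _.
rewrite normrM.
have h4 : `|obs (al i) n w| * `|Rw n w| <= D1 * `|Rw n w| by rewrite ler_wpM2r.
apply: le_trans (lerD (lerD h4 (lexx _)) (lexx _)) _.
have dB : 0 <= dim%:R * B by rewrite mulr_ge0.
have := normr_ge0 (Rw n w); move: (dim%:R * B) (`|Rw n w|) dB => m x m0 x0.
have := mulr_ge0 D10 m0; have := mulr_ge0 D20 m0; have := mulr_ge0 D30 m0.
have := mulr_ge0 D10 x0; have := mulr_ge0 D20 x0; have := mulr_ge0 D30 x0.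
have := mulr_ge0 (mulr_ge0 D10 m0) x0.
have := mulr_ge0 (mulr_ge0 D20 m0) x0.
have := mulr_ge0 (mulr_ge0 D30 m0) x0.
nra.
Qed.

Let e0 n : 0 <= e n. Proof. by rewrite addr_ge0// sqr_ge0. Qed.

(** On a bounded trajectory an increment is at most the step size times a multiple
of [1 + |R_n|], and [reward_series_cvg] applies to the products of two step
sizes. *)
Let increments_cvg (c' c : nat -> R) N (x : nat -> T -> 'cV[R]_dim) :
  (forall n, 0 <= c' n) -> (forall n, 0 <= c n) -> (forall n, c' n * c n <= e n) ->
  (forall n w i, x n.+1 w i 0 = x n w i 0 + c n * drive N i n w) ->
  {ae P, forall w, forall i, cvgn (series (fun n => c' n * `|x n.+1 w i 0 - x n w i 0|))}.
Proof.
move=> c'0 c0 cc xrec; have [D D0 DP] := drive_le N.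
apply: filterS2 stable (reward_series_cvg e0 ab_sq) => w [B wB] rc i.
apply: (@series_le_cvg _ _ (fun n => `|D * (1 + dim%:R * B)| * (e n * (1 + `|Rw n w|)))).
- by move=> n; rewrite mulr_ge0.
- by move=> n; rewrite mulr_ge0// mulr_ge0// addr_ge0.
- move=> n; rewrite xrec addrAC subrr add0r normrM (ger0_norm (c0 n)) mulrA.
  rewrite [leRHS]mulrCA; apply: ler_pM => //; first by rewrite mulr_ge0.
  apply: le_trans (DP w B wB i n) _; by rewrite ler_wpM2r// ler_norm.
- exact: cvgn_seriesZ.
Qed.

Let centered (al0 be0 : S -> U -> S -> R) n w :=
  obs al0 n w * Rw n w + obs be0 n w - stationary_mean al0 be0.

Let zero3 : S -> U -> S -> R := fun _ _ _ => 0.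

(** The part of [drive] that is left when every observable is replaced by its
deviation from its stationary mean. *)
Let noise_term N i n w := centered (al i) zero3 n w
  - (\sum_k centered zero3 (A i k) n w * theta n w k 0)
  - \sum_k centered zero3 (N i k) n w * wt n w k 0.

Let noise_term_cvg (c : nat -> R) N :
  (forall n, 0 <= c n) -> (forall n, c n.+1 <= c n) ->
  (forall n, c n * c n <= e n) ->
  (forall n, c n * a n <= e n) -> (forall n, c n * b n <= e n) ->
  {ae P, forall w, forall i, cvgn (series (fun n => c n * noise_term N i n w))}.
Proof.
move=> c0 cn ce ca cb.
have c2 : cvgn (series (fun n => c n ^+ 2)).
  by apply: series_le_cvg ab_sq => // n; rewrite sqr_ge0.
have cc := square_summable_cvg0 c0 c2.
have SN al0 be0 zeta := @state_noise_cvg al0 be0 zeta c c0 cn cc c2.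
have H1 : {ae P, forall w, forall i, cvgn (series (fun n => c n * 1 * centered (al i) zero3 n w))}.
  apply: ae_forall_fin => i; apply: (SN (al i) zero3 (fun _ _ => 1)).
  - by move=> n; exact: measurable_cst.
  - by apply: aeW => w; exists 1 => n; rewrite normr1.
  - apply: aeW => w; rewrite (_ : series _ = fun=> 0); first exact: is_cvg_cst.
    by apply/funext => n; rewrite /series/= big1// => k _; rewrite subrr normr0 mulr0.
have H2 (M : 'I_dim -> 'I_dim -> S -> U -> S -> R) :
  {ae P, forall w, forall ik : 'I_dim * 'I_dim, cvgn
    (series (fun n => c n * theta n w ik.2 0 * centered zero3 (M ik.1 ik.2) n w))}.
  apply: ae_forall_fin => ik; apply: (SN zero3 (M ik.1 ik.2) (fun n w => theta n w ik.2 0)).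
  - by move=> n; exact: (adapted_iterates n _).1.
  - by apply: filterS stable => w [B wB]; exists B => n; exact: (wB n _).1.
  - have := increments_cvg c0 (fun n => ltW (a0 n)) ca theta_rec.
    by apply: filterS => w; apply.
have H3 (M : 'I_dim -> 'I_dim -> S -> U -> S -> R) :
  {ae P, forall w, forall ik : 'I_dim * 'I_dim, cvgn
    (series (fun n => c n * wt n w ik.2 0 * centered zero3 (M ik.1 ik.2) n w))}.
  apply: ae_forall_fin => ik; apply: (SN zero3 (M ik.1 ik.2) (fun n w => wt n w ik.2 0)).
  - by move=> n; exact: (adapted_iterates n _).2.
  - by apply: filterS stable => w [B wB]; exists B => n; exact: (wB n _).2.
  - have := increments_cvg c0 (fun n => ltW (b0 n)) cb wt_rec.
    by apply: filterS => w; apply.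
apply: filterS3 H1 (H2 A) (H3 N) => w h1 h2 h3 i.
rewrite (_ : (fun n => _) = fun n => c n * 1 * centered (al i) zero3 n w +
  (-1 * (\sum_k c n * theta n w k 0 * centered zero3 (A i k) n w) +
   -1 * \sum_k c n * wt n w k 0 * centered zero3 (N i k) n w)).
  apply: cvgn_seriesD => //; apply: cvgn_seriesD; apply: cvgn_seriesZ; apply: cvgn_series_sum => k.
  - exact: (h2 (i, k)).
  - exact: (h3 (i, k)).
apply/funext => n; rewrite /noise_term !mulrBr mulr1 !mulN1r addrA !mulr_sumr.
by congr (_ - _ - _); apply: eq_bigr => k _; rewrite -mulrA; congr (_ * _); rewrite mulrC.
Qed.

Variables (Am Cm : 'M[R]_dim) (bv thstar : 'cV[R]_dim).
Hypotheses (bvE : forall i, stationary_mean (al i) zero3 = bv i 0)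
  (AmE : forall i k, stationary_mean zero3 (A i k) = Am i k)
  (N1E : forall i k, stationary_mean zero3 (N1 i k) = (Cm - Am^T) i k)
  (N2E : forall i k, stationary_mean zero3 (N2 i k) = Cm i k)
  (Cm_sym : Cm^T = Cm) (Cm_psd : forall u, 0 <= dotv u (Cm *m u))
  (Cm_unit : Cm \in unitmx) (Am_unit : Am \in unitmx)
  (thstarE : Am *m thstar = bv).
Hypotheses (a_sum : series a n @[n --> \oo] --> +oo)
  (b_sum : series b n @[n --> \oo] --> +oo)
  (ab_ratio : (a n / b n) @[n --> \oo] --> (0 : R)).

Let drive_noise N (Nm : 'M[R]_dim) i n w :
  (forall i k, stationary_mean zero3 (N i k) = Nm i k) ->
  drive N i n w = (bv - Am *m theta n w - Nm *m wt n w) i 0 + noise_term N i n w.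
Proof.
move=> NE; rewrite /drive /noise_term /centered bvE.
have E (M : 'I_dim -> 'I_dim -> S -> U -> S -> R) (Mm : 'M[R]_dim) (x : 'cV[R]_dim) :
    (forall i k, stationary_mean zero3 (M i k) = Mm i k) ->
    \sum_k (obs zero3 n w * Rw n w + obs (M i k) n w - stationary_mean zero3 (M i k)) * x k 0 =
    (\sum_k obs (M i k) n w * x k 0) - (Mm *m x) i 0.
  move=> ME; rewrite [(Mm *m x) i 0]mxE -sumrB; apply: eq_bigr => k _.
  by rewrite ME {1}/obs /zero3 mul0r add0r mulrBl.
rewrite (E _ _ _ AmE) (E _ _ _ NE) (_ : obs zero3 n w = 0)//.
have entry (x y z : 'cV[R]_dim) : (x - y - z) i 0 = x i 0 - y i 0 - z i 0 by rewrite !mxE.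
by rewrite entry; ring.
Qed.

Let e_bound x y : x ^+ 2 + y ^+ 2 >= x * y :> R.
Proof. have := sqr_ge0 (x - y); have := sqr_ge0 (x + y); nra. Qed.

Lemma driven_recursion_cvg :
  {ae P, forall w, forall i, theta n w i 0 @[n --> \oo] --> thstar i 0}.
Proof.
have ge_a n : a n * a n <= e n by rewrite -expr2 lerDl sqr_ge0.
have ge_b n : b n * b n <= e n by rewrite -expr2 lerDr sqr_ge0.
have ge_ab n : a n * b n <= e n by exact: e_bound.
have ge_ba n : b n * a n <= e n by rewrite mulrC.
have sq0 (c : nat -> R) : (forall n, 0 < c n) -> (forall n, c n * c n <= e n) -> c n @[n --> \oo] --> 0.
  move=> c0 ce.
  have c2 : cvgn (series (fun n => c n ^+ 2)).
    by apply: series_le_cvg ab_sq => // n; rewrite sqr_ge0.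
  by apply: square_summable_cvg0 => // n; exact: ltW.
have H1 := noise_term_cvg N1 (fun n => ltW (a0 n)) a_ninc ge_a ge_a ge_ab.
have H2 := noise_term_cvg N2 (fun n => ltW (b0 n)) b_ninc ge_b ge_ba ge_b.
apply: filterS3 stable H1 H2 => w [B wB] h1 h2.
have sqB (x : nat -> 'cV[R]_dim) : (forall n i, `|x n i 0| <= B) ->
    forall n, dotv (x n) (x n) <= dim%:R * B ^+ 2.
  move=> xB n; rewrite dotvE mulr_natl -[X in _ *+ X]card_ord -sumr_const.
  apply: ler_sum => i _; rewrite -expr2 -(real_normK (num_real _)).
  by rewrite ler_pXn2r ?nnegrE// (le_trans (normr_ge0 _) (xB n i)).
have entry (x y z : 'cV[R]_dim) k i :
    (x + k *: (y + z)) i 0 = x i 0 + k * (y i 0 + z i 0) by rewrite !mxE.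
apply: (@tdc_pathwise_cvg _ _ Am Cm bv thstar a b (theta ^~ w) (wt ^~ w)
  (fun n => \col_i noise_term N1 i n w) (fun n => \col_i noise_term N2 i n w)
  Cm_sym Cm_psd Cm_unit Am_unit thstarE a0 b0 (sq0 a a0 ge_a) (sq0 b b0 ge_b) a_sum b_sum ab_ratio
  (dim%:R * B ^+ 2)).
- by apply: sqB => n i; exact: (wB n i).1.
- by apply: sqB => n i; exact: (wB n i).2.
- by move=> i; under eq_fun do rewrite mxE; exact: h1.
- by move=> i; under eq_fun do rewrite mxE; exact: h2.
- move=> n; apply/colP => i; rewrite theta_rec (drive_noise _ _ _ N1E).
  by rewrite entry; congr (_ + _ * (_ + _)); rewrite mxE.
- move=> n; apply/colP => i; rewrite wt_rec (drive_noise _ _ _ N2E).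
  by rewrite entry; congr (_ + _ * (_ + _)); rewrite mxE.
Qed.

End trajectory.

(** * Expectations under the stationary law *)

Section stationary_expectations.
Context (R : realType) (S U : finType) (p : S -> U -> S -> R) (r : S -> U -> S -> R)
  (q : S -> U -> S -> probability R R) (pib : S -> U -> R) (nu : S -> R).
Hypotheses (p_distr : forall s a, is_distr (p s a))
  (q_int : forall s a s', (q s a s').-integrable setT (fun x : R => x%:E))
  (q_mean : forall s a s', (\int[q s a s']_x x%:E = (r s a s')%:E)%E)
  (pib_distr : forall s, is_distr (pib s))
  (nu_distr : is_distr nu).

Definition transition_mean (g : S -> U -> S -> R) : R :=
  \sum_s \sum_u \sum_s' nu s * pib s u * p s u s' * g s u s'.

Lemma stationary_meanE (al be : S -> U -> S -> R) :
  stationary_mean p r pib nu al be =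
  transition_mean (fun s u s' => al s u s' * r s u s' + be s u s').
Proof.
apply: eq_bigr => s _; rewrite /step_mean mulr_sumr; apply: eq_bigr => u _.
by rewrite mulr_sumr; apply: eq_bigr => s' _; rewrite !mulrA.
Qed.

Lemma stat_mean_affine m n (f : S -> U -> R -> S -> 'M[R]_(m, n)) i j
    (al be : S -> U -> S -> R) :
  (forall s u x s', f s u x s' i j = al s u s' * x + be s u s') ->
  stat_mean nu pib p q f i j =
  transition_mean (fun s u s' => al s u s' * r s u s' + be s u s').
Proof.
move=> fE; rewrite mxE; apply: eq_bigr => s _; apply: eq_bigr => u _.
apply: eq_bigr => s' _; congr (_ * _).
have [_ E] := affine_reward_mean q_int q_mean (al s u s') (be s u s') s u s'.
rewrite -[RHS]/(fine (al s u s' * r s u s' + be s u s')%:E) -E /Rintegral.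
by congr fine; apply: eq_integral => x _; rewrite fE.
Qed.

Lemma eq_transition_mean (g h : S -> U -> S -> R) :
  (forall s u s', g s u s' = h s u s') -> transition_mean g = transition_mean h.
Proof.
move=> gh; apply: eq_bigr => s _; apply: eq_bigr => u _.
by apply: eq_bigr => s' _; rewrite gh.
Qed.

Lemma transition_meanB (g h : S -> U -> S -> R) :
  transition_mean g - transition_mean h =
  transition_mean (fun s u s' => g s u s' - h s u s').
Proof.
rewrite -sumrB; apply: eq_bigr => s _; rewrite -sumrB; apply: eq_bigr => u _.
by rewrite -sumrB; apply: eq_bigr => s' _; rewrite mulrBr.
Qed.

Lemma transition_meanM (g : S -> U -> S -> R) (k : R) :
  transition_mean g * k = transition_mean (fun s u s' => g s u s' * k).
Proof.
rewrite mulr_suml; apply: eq_bigr => s _; rewrite mulr_suml; apply: eq_bigr => u _.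
by rewrite mulr_suml; apply: eq_bigr => s' _; rewrite mulrA.
Qed.

Lemma transition_mean_sum (I : finType) (g : I -> S -> U -> S -> R) :
  \sum_i transition_mean (g i) = transition_mean (fun s u s' => \sum_i g i s u s').
Proof.
rewrite exchange_big/=; apply: eq_bigr => s _; rewrite exchange_big/=; apply: eq_bigr => u _.
by rewrite exchange_big/=; apply: eq_bigr => s' _; rewrite mulr_sumr.
Qed.

Lemma transition_mean_ge0 (g : S -> U -> S -> R) :
  (forall s u s', 0 <= g s u s') -> 0 <= transition_mean g.
Proof.
move=> g0; apply: sumr_ge0 => s _; apply: sumr_ge0 => u _; apply: sumr_ge0 => s' _.
have [p0 _] := p_distr s u; have [b0 _] := pib_distr s; have [n0 _] := nu_distr.
by rewrite mulr_ge0// mulr_ge0// mulr_ge0.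
Qed.

(** On functions of the current state importance weighting changes nothing, since
the action and the next state integrate out under either policy.  This is what
relates the matrix of the correction term to [C - A^T]. *)
Lemma transition_mean_isratio (pi : S -> U -> R) (g : S -> R) :
  (forall s, is_distr (pi s)) -> (forall s u, 0 < pib s u) ->
  transition_mean (fun s u s' => isratio pi pib s u * g s) =
  transition_mean (fun s u s' => g s).
Proof.
move=> pi_distr pib0.
have E (pol : S -> U -> R) : (forall s, is_distr (pol s)) ->
    \sum_s \sum_u \sum_s' nu s * pol s u * p s u s' * g s = \sum_s nu s * g s.
  move=> polD; apply: eq_bigr => s _.
  transitivity (\sum_u nu s * g s * pol s u).
    apply: eq_bigr => u _; rewrite -mulr_suml -mulr_sumr.
    by have [_ ->] := p_distr s u; rewrite mulr1 mulrAC.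
  by rewrite -mulr_sumr; have [_ ->] := polD s; rewrite mulr1.
rewrite /transition_mean (E _ pib_distr) -(E _ pi_distr).
apply: eq_bigr => s _; apply: eq_bigr => u _; apply: eq_bigr => s' _.
by rewrite /isratio; field; rewrite gt_eqF.
Qed.

End stationary_expectations.

Theorem theorem5p1 (R : realType) (disp : measure_display)
  (T : measurableType disp) (P : probability T R)
  (S U : finType) (dim : nat)
  (* the Markov decision process, policies, discount factor and features *)
  (p : S -> U -> S -> R) (r : S -> U -> S -> R)
  (q : S -> U -> S -> probability R R)
  (pi pib : S -> U -> R) (gamma : R) (phi : S -> 'cV[R]_dim)
  (p_distr : forall s a, is_distr (p s a))
  (q_int : forall s a s', (q s a s').-integrable setT (fun x : R => x%:E))
  (q_mean : forall s a s', (\int[q s a s']_x x%:E = (r s a s')%:E)%E)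
  (pi_distr : forall s, is_distr (pi s))
  (pib_distr : forall s, is_distr (pib s))
  (gamma_bnd : 0 < gamma < 1)
  (* the trajectory and the TDC iterates *)
  (X : nat -> T -> S) (Ac : nat -> T -> U) (Rw : nat -> T -> R)
  (theta wt : nat -> T -> 'cV[R]_dim) (a b : nat -> R)
  (X_meas : forall n s, measurable (X n @^-1` [set s]))
  (Ac_meas : forall n u, measurable (Ac n @^-1` [set u]))
  (Rw_meas : forall n, measurable_fun setT (Rw n))
  (theta0_meas : forall i, measurable_fun setT (fun w => theta 0%N w i 0))
  (wt0_meas : forall i, measurable_fun setT (fun w => wt 0%N w i 0))
  (traj : generated_by P pib p q (theta 0%N) (wt 0%N) X Ac Rw)
  (theta_rec : forall n w,
    let phin := phi (X n w) in let phin' := phi (X n.+1 w) in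
    let rho := isratio pi pib (X n w) (Ac n w) in
    let delta := td gamma phi (theta n w) (X n w) (Rw n w) (X n.+1 w) in
    theta n.+1 w = theta n w +
      (a n * rho) *: (delta *: phin - gamma *: (phin' *m phin^T *m wt n w)))
  (wt_rec : forall n w,
    let phin := phi (X n w) in
    let rho := isratio pi pib (X n w) (Ac n w) in
    let delta := td gamma phi (theta n w) (X n w) (Rw n w) (X n.+1 w) in
    wt n.+1 w = wt n w +
      b n *: ((rho * delta - dotv phin (wt n w)) *: phin))
  (* (i) step sizes *)
  (a_gt0 : forall n, 0 < a n) (b_gt0 : forall n, 0 < b n)
  (a_ninc : forall n, a n.+1 <= a n) (b_ninc : forall n, b n.+1 <= b n)
  (a_sum : series a n @[n --> \oo] --> +oo)
  (b_sum : series b n @[n --> \oo] --> +oo)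
  (ab_sq : cvgn (series (fun n => a n ^+ 2 + b n ^+ 2)))
  (ab_ratio : (a n / b n) @[n --> \oo] --> (0 : R))
  (* (ii) the state process and the rewards *)
  (X_markov : markov_chain P (state_kernel pib p) X)
  (X_irr : irreducible_kernel (state_kernel pib p))
  (nu : S -> R) (nu_stat : unique_stationary (state_kernel pib p) nu)
  (Rw_mean : forall n s s',
    let E := [set w | X n w = s /\ X n.+1 w = s'] in
    (0 < P E)%E ->
    cond_mean P (Rw n) E = (\sum_u pib s u * r s u s')%:E)
  (Rw_sq : forall n s s',
    let E := [set w | X n w = s /\ X n.+1 w = s'] in
    (0 < P E)%E -> (cond_mean P (fun w => Rw n w ^+ 2)%R E < +oo)%E)
  (pi_neq : pi <> pib)
  (* (iii) non-singularity *)
  (Cmx Amx : 'M[R]_dim)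
  (Cmx_def : Cmx = stat_mean nu pib p q (fun s _ _ _ => phi s *m (phi s)^T))
  (Amx_def : Amx = stat_mean nu pib p q (fun s u _ s' =>
    isratio pi pib s u *: (phi s *m (phi s - gamma *: phi s')^T)))
  (Cmx_unit : Cmx \in unitmx) (Amx_unit : Amx \in unitmx)
  (* (iv) exploration *)
  (pib_gt0 : forall s u, 0 < pib s u)
  (* (v) stability *)
  (stable : {ae P, forall w,
    has_ubound (range (fun n => `|theta n w| + `|wt n w|))}) :
  let bvec := stat_mean nu pib p q (fun s u x _ =>
    (isratio pi pib s u * x) *: phi s) in
  let td_eq th := \sum_s \sum_u \sum_s'
    (nu s * pi s u * p s u s' * td gamma phi th s (r s u s') s') *: phi s in
  (forall th : 'cV[R]_dim,
     td_eq th = stat_mean nu pib p q (fun s u x s' =>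
       (isratio pi pib s u * td gamma phi th s x s') *: phi s) /\
     td_eq th = bvec - Amx *m th) /\
  exists thstar : 'cV[R]_dim,
    [/\ 0 = td_eq thstar,
        forall th : 'cV[R]_dim, 0 = td_eq th -> th = thstar
      & {ae P, forall w, theta n w @[n --> \oo] --> thstar}].
Proof.
move=> bvec td_eq.
have [[nu_distr _] _] := nu_stat.
pose tm := transition_mean p pib nu.
(* the coefficients of the two updates, coordinate by coordinate: al multiplies the
   reward, A and N1 multiply theta and w in the slow update, A and N2 in the fast
   one *)
pose al i s u (_ : S) : R := isratio pi pib s u * phi s i 0.
pose A i k s u s' : R :=
  isratio pi pib s u * (phi s i 0 * (phi s k 0 - gamma * phi s' k 0)).
pose N1 i k s u s' : R := isratio pi pib s u * (gamma * (phi s' i 0 * phi s k 0)).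
pose N2 i k s (_ : U) (_ : S) : R := phi s i 0 * phi s k 0.
have AmxE i k : Amx i k = tm (A i k).
  rewrite Amx_def (@stat_mean_affine _ _ _ p r q pib nu q_int q_mean
    _ _ _ _ _ (fun _ _ _ => 0) (A i k)).
    by apply: eq_transition_mean => s u s'; rewrite mul0r add0r.
  by move=> s u x s'; rewrite mul0r add0r !mxE big_ord1 !mxE.
have CmxE i k : Cmx i k = tm (N2 i k).
  rewrite Cmx_def (@stat_mean_affine _ _ _ p r q pib nu q_int q_mean
    _ _ _ _ _ (fun _ _ _ => 0) (N2 i k)).
    by apply: eq_transition_mean => s u s'; rewrite mul0r add0r.
  by move=> s u x s'; rewrite mul0r add0r !mxE big_ord1 !mxE.
have bvecE i : bvec i 0 = tm (fun s u s' => al i s u s' * r s u s').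
  rewrite /bvec (@stat_mean_affine _ _ _ p r q pib nu q_int q_mean
    _ _ _ _ _ (al i) (fun _ _ _ => 0)).
    by apply: eq_transition_mean => s u s'; rewrite addr0.
  by move=> s u x s'; rewrite addr0 !mxE /al; ring.
have td_eqE th i : td_eq th i 0 =
    tm (fun s u s' => isratio pi pib s u * td gamma phi th s (r s u s') s' * phi s i 0).
  rewrite /td_eq summxE; apply: eq_bigr => s _; rewrite summxE; apply: eq_bigr => u _.
  rewrite summxE; apply: eq_bigr => s' _; rewrite mxE /isratio.
  by field; rewrite gt_eqF.
have td_eq_stat th : td_eq th = stat_mean nu pib p q (fun s u x s' =>
    (isratio pi pib s u * td gamma phi th s x s') *: phi s).
  apply/colP => i; rewrite td_eqE.
  rewrite (@stat_mean_affine _ _ _ p r q pib nu q_int q_mean _ _ _ _ _ (al i) (fun s u s' =>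
    isratio pi pib s u * (gamma * dotv th (phi s') - dotv th (phi s)) * phi s i 0)).
    by apply: eq_transition_mean => s u s'; rewrite /td /al; ring.
  by move=> s u x s'; rewrite mxE /td /al; ring.
have A_sum i s u s' (th : 'cV[R]_dim) : \sum_k A i k s u s' * th k 0 =
    isratio pi pib s u * phi s i 0 * (dotv th (phi s) - gamma * dotv th (phi s')).
  rewrite !dotvE [gamma * _]mulr_sumr -sumrB mulr_sumr; apply: eq_bigr => k _.
  by rewrite /A; ring.
have td_eq_lin th : td_eq th = bvec - Amx *m th.
  apply/colP => i; rewrite td_eqE.
  rewrite [RHS]mxE [X in _ = _ + X]mxE [X in _ = _ - X]mxE bvecE.
  under [X in _ = _ - X]eq_bigr => k _ do rewrite AmxE /tm transition_meanM.
  rewrite transition_mean_sum transition_meanB; apply: eq_transition_mean => s u s'.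
  by rewrite A_sum /td /al; ring.
split; first by move=> th; split.
exists (invmx Amx *m bvec).
have thE : Amx *m (invmx Amx *m bvec) = bvec by rewrite mulKVmx.
split.
- by rewrite td_eq_lin thE subrr.
- by move=> th; rewrite td_eq_lin => /esym/eqP; rewrite subr_eq0 => /eqP ->; rewrite mulKmx.
(* E[rho gamma phi' phi^T] = C - A^T, the identity behind the correction term *)
have N1E i k : stationary_mean p r pib nu (fun _ _ _ => 0) (N1 i k) = (Cmx - Amx^T) i k.
  rewrite stationary_meanE !mxE CmxE AmxE.
  rewrite /tm -(transition_mean_isratio nu p_distr pib_distr
    (fun s => phi s i 0 * phi s k 0) pi_distr pib_gt0).
  rewrite transition_meanB; apply: eq_transition_mean => s u s'.
  by rewrite /N1 /A; ring.
have Cmx_sym : Cmx^T = Cmx.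
  by apply/matrixP => i k; rewrite mxE !CmxE; apply: eq_transition_mean => s u s'; rewrite /N2 mulrC.
have Cmx_psd u : 0 <= dotv u (Cmx *m u).
  (* <u, C u> is the second moment of <u, phi(X)> *)
  have -> : dotv u (Cmx *m u) = tm (fun s _ _ => dotv u (phi s) ^+ 2).
    rewrite dotvE.
    transitivity (\sum_i \sum_k tm (fun s v s' => N2 i k s v s' * (u k 0 * u i 0))).
      apply: eq_bigr => i _; rewrite mxE mulr_sumr; apply: eq_bigr => k _.
      by rewrite CmxE /tm -transition_meanM; ring.
    under eq_bigr do rewrite /tm transition_mean_sum.
    rewrite transition_mean_sum; apply: eq_transition_mean => s v s'.
    rewrite dotvE expr2 mulr_suml; apply: eq_bigr => i _; rewrite mulr_sumr.
    by apply: eq_bigr => k _; rewrite /N2; ring.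
  by apply: transition_mean_ge0 => // s v s'; exact: sqr_ge0.
have [M2 Rw_M2] := reward_second_moment_bounded p_distr pib_distr X_meas Ac_meas
  Rw_meas theta0_meas wt0_meas traj Rw_sq.
have := @driven_recursion_cvg _ _ _ _ _ _ _ p r q pib _ _ X Ac Rw p_distr q_int q_mean
  pib_distr X_meas Ac_meas Rw_meas theta0_meas wt0_meas traj M2 Rw_M2 nu X_irr nu_stat.1
  theta wt a b al A N1 N2 erefl erefl a_gt0 b_gt0 a_ninc b_ninc ab_sq _ _ _
  Amx Cmx bvec (invmx Amx *m bvec) _ _ N1E _ Cmx_sym Cmx_psd Cmx_unit Amx_unit thE
  a_sum b_sum ab_ratio.
move=> main.
have entry (x y z : 'cV[R]_dim) (k c c' : R) i :
    (x + k *: (c *: y - c' *: z)) i 0 = x i 0 + k * (c * y i 0 - c' * z i 0).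
  by rewrite !mxE.
have entry' (x y : 'cV[R]_dim) (k c : R) i :
    (x + k *: (c *: y)) i 0 = x i 0 + k * (c * y i 0).
  by rewrite !mxE.
have outer (x y z : 'cV[R]_dim) i : (x *m y^T *m z) i 0 = x i 0 * dotv y z.
  rewrite mxE dotvE mulr_sumr; apply: eq_bigr => k _.
  by rewrite mxE big_ord1 mxE mulrA.
have {main} : {ae P, forall w, forall i, theta n w i 0 @[n --> \oo] --> (invmx Amx *m bvec) i 0}.
  apply: main.
  - move=> n w i; rewrite theta_rec entry outer A_sum.
    rewrite (_ : \sum_k _ = isratio pi pib (X n w) (Ac n w) *
        (gamma * phi (X n.+1 w) i 0) * dotv (phi (X n w)) (wt n w)).
      by rewrite /td /al; ring.
    by rewrite dotvE mulr_sumr; apply: eq_bigr => k _; rewrite /N1; ring.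
  - move=> n w i; rewrite wt_rec entry' A_sum.
    rewrite (_ : \sum_k _ = phi (X n w) i 0 * dotv (phi (X n w)) (wt n w)).
      by rewrite /td /al; ring.
    by rewrite dotvE mulr_sumr; apply: eq_bigr => k _; rewrite /N2; ring.
  - apply: filterS stable => w [B wB]; exists B => n i.
    have h : `|theta n w| + `|wt n w| <= B by apply: wB; exists n.
    split; [apply: le_trans (le_entry_norm _ _) _|apply: le_trans (le_entry_norm _ _) _];
    by apply: le_trans h; rewrite ?lerDl ?lerDr.
  - move=> i; rewrite stationary_meanE bvecE; apply: eq_transition_mean => s u s'.
    by rewrite addr0.
  - move=> i k; rewrite stationary_meanE AmxE; apply: eq_transition_mean => s u s'.
    by rewrite mul0r add0r.
  - move=> i k; rewrite stationary_meanE CmxE; apply: eq_transition_mean => s u s'.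
    by rewrite mul0r add0r.
by apply: filterS => w h; exact: cvg_colP.
Qed.
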